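(* Let $g:\mathbb{R}^n\to\mathbb{R}$ be a polynomial that is convex over $[-1,1]^n$. For $d'\in\mathbb{N}$, define $$\Theta_{d'}(x_1,\ldots,x_n)=\sum_{1\le i\le n}x_i^2+\sum_{1\le i<j\le n}\left(8x_i^{2d'+2}+x_i^{2d'}x_j^2+x_i^2x_j^{2d'}+8x_j^{2d'+2}\right).$$ For any $\epsilon>0$, there exists $d_0'$ such that $g_\epsilon:=g+\epsilon\,\Theta_{d'}$ is sos-convex for all $d'\ge d_0'$.
   Context: A function $g$ is convex over the box $[-1,1]^n$ if $g(\lambda x+(1-\lambda)y)\le\lambda g(x)+(1-\lambda)g(y)$ for all $x,y\in[-1,1]^n$ and $\lambda\in[0,1]$. A real polynomial is a sum of squares (sos) if it is a finite sum of squares of real polynomials. A $t\times t$ polynomial matrix $M(x)$ is an sos matrix if $M(x)=V(x)^TV(x)$ for some $t'\times t$ polynomial matrix $V(x)$; equivalently, the polynomial $y^TM(x)y$ in $x$ and $y$ is sos. A polynomial $p$ is sos-convex if its Hessian $H_p(x)$ is an sos matrix.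
   Formalization: The case n = 1 is excluded: there the sum over i<j is empty, so Θ = x² for every d', and the claim fails, e.g. g = 6x² − x⁴ is convex on [−1,1], but with ε = 1 the second derivative 14 − 12x² is negative at x = 2. *)

(* Defs.v *)
From mathcomp Require Import all_boot all_order all_algebra.
From mathcomp Require Import reals mpoly.

Set Implicit Arguments.
Unset Strict Implicit.
Unset Printing Implicit Defensive.

Import Order.TTheory GRing.Theory Num.Theory.
Local Open Scope ring_scope.

Definition in_box (R : realType) (n : nat) (x : 'I_n -> R) : Prop :=
  forall i : 'I_n, -1 <= x i <= 1.

Definition convex_on_box (R : realType) (n : nat) (g : ('I_n -> R) -> R) :
    Prop :=
  forall x y : 'I_n -> R, in_box x -> in_box y ->
  forall l : R, 0 <= l <= 1 ->
  g (fun i => l * x i + (1 - l) * y i) <= l * g x + (1 - l) * g y.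

Definition sos_matrix (R : realType) (n t : nat)
    (M : 'M[{mpoly R[n]}]_t) : Prop :=
  exists (t' : nat) (V : 'M[{mpoly R[n]}]_(t', t)), M = V^T *m V.

Definition hessian (R : realType) (n : nat) (p : {mpoly R[n]}) :
    'M[{mpoly R[n]}]_n :=
  \matrix_(i < n, j < n) p^`M(i)^`M(j).

Definition sos_convex (R : realType) (n : nat) (p : {mpoly R[n]}) : Prop :=
  sos_matrix (hessian p).

Definition Theta (R : realType) (n d : nat) : {mpoly R[n]} :=
  \sum_(i < n) 'X_i ^+ 2 +
  \sum_(i < n) \sum_(j < n | (i < j)%N)
    (8%:R * 'X_i ^+ (2 * d + 2)
     + 'X_i ^+ (2 * d) * 'X_j ^+ 2
     + 'X_i ^+ 2 * 'X_j ^+ (2 * d)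
     + 8%:R * 'X_j ^+ (2 * d + 2)).

(* Main.v *)
Require Import Defs.
From mathcomp Require Import all_boot all_order all_algebra.
From mathcomp Require Import reals mpoly ring lra.

Set Implicit Arguments.
Unset Strict Implicit.
Unset Printing Implicit Defensive.

Import Order.TTheory GRing.Theory Num.Theory.
Local Open Scope ring_scope.

(** Write [tail D] for [1 + sum_i x_i^(2D)] and call a polynomial (or a symmetric
    polynomial matrix) [p] an approximate sum of squares when, for every
    [e > 0], [p + e * tail D] is a sum of squares for all large [D].  The theorem
    is the conjunction of two facts: the Hessian of [g] is an approximate sum of
    squares ([hessian_psd] and [approx_sos_matrix_psd]), and the Hessian of
    [Theta] exceeds [tail d] times the identity by a sum of squares
    ([sos_matrix_hessian_Theta]).

    Approximate sums of squares form a cone that contains the squares and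
    the polynomials [1 - x_i] and [1 + x_i] ([approx_sos_1X]), is stable under
    products ([approx_sosM]) and contains [p] as soon as it contains [p + e] for
    every constant [e > 0] ([approx_sos_closed]).  Stability
    under products is the delicate point: the error terms have the form
    [e * tail D * p], and they are absorbed because every polynomial is bounded
    by a multiple of [tail D'] whose constant does not depend on the degree
    ([tail_bounded_ex], [tail_boundedM]).

    In such a cone Bernstein approximation can be carried out algebraically.
    There are partitions of unity [sum_k b_k = 1] by members [b_k] of the cone,
    attached to points [z_k] of the box, of arbitrarily small variance
    [sum_k b_k * (x_i - z_k_i)^2] ([quadrature_ex]).  A polynomial oscillates
    little near a point ([dominated_oscillation]), so every polynomial matrix
    [H] differs from [sum_k b_k * H(z_k)] by a matrix whose entries lie between
    two small constants in the order of the cone.  If [H] is positive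
    semidefinite on the box, each [H(z_k)] is a sum of constant matrices
    [v^T v] ([psd_gram]); hence [sum_k b_k * H(z_k)], and with it [H], is an
    approximate sum of squares. *)

(** * Sums of squares and bounds by a tail *)

Section Sos.
Variables (R : realType) (n : nat).
Implicit Types (p q u v : {mpoly R[n]}) (c e : R) (D : nat).

(** Evaluation, domination and differentiation along a line are compatible with
    sums and products, so induction over these is more convenient than
    induction over monomials. *)
Lemma mpoly_ring_ind (P : {mpoly R[n]} -> Prop) :
  (forall c, P c%:MP) -> (forall i, P 'X_i) ->
  (forall p q, P p -> P q -> P (p + q)) ->
  (forall p q, P p -> P q -> P (p * q)) -> forall p, P p.
Proof.
move=> PC PX PD PM; elim/mpolyind => [|c m p _ _ Pp]; first exact: (PC 0).
apply: PD Pp; rewrite -mul_mpolyC; apply: (PM) => //.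
rewrite mpolyXE_id; apply: big_ind => [||i _]; [exact: (PC 1) | exact: PM |].
elim: (m i) => [|k IHk]; first by rewrite expr0; exact: (PC 1).
by rewrite exprS; apply: (PM).
Qed.

Lemma mpoly_half : 2%:R^-1%:MP * 2%:R = 1 :> {mpoly R[n]}.
Proof. by rewrite -mpolyC_nat -mpolyCM mulVf ?pnatr_eq0 // mpolyC1. Qed.

Definition sos p := exists s : seq {mpoly R[n]}, p = \sum_(q <- s) q ^+ 2.

Lemma sos0 : sos 0.
Proof. by exists [::]; rewrite big_nil. Qed.

Lemma sos_sqr q : sos (q ^+ 2).
Proof. by exists [:: q]; rewrite big_seq1. Qed.

Lemma sosD p q : sos p -> sos q -> sos (p + q).
Proof. by move=> [s ->] [t ->]; exists (s ++ t); rewrite big_cat. Qed.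

Lemma sos_sum (I : Type) (r : seq I) (P : pred I) (F : I -> {mpoly R[n]}) :
  (forall i, P i -> sos (F i)) -> sos (\sum_(i <- r | P i) F i).
Proof. by move=> h; apply: big_ind => //; [exact: sos0 | exact: sosD]. Qed.

Lemma sosM p q : sos p -> sos q -> sos (p * q).
Proof.
move=> [s ->] [t ->]; rewrite mulr_suml; apply: sos_sum => a _.
rewrite mulr_sumr; apply: sos_sum => b _; rewrite -exprMn; exact: sos_sqr.
Qed.

Lemma sosC c : 0 <= c -> sos c%:MP.
Proof. by move=> c0; rewrite -(sqr_sqrtr c0) rmorphXn; exact: sos_sqr. Qed.

Lemma sosn k : sos k%:R.
Proof. by rewrite -mpolyC_nat; apply: sosC. Qed.

Lemma sosX p k : sos p -> sos (p ^+ k).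
Proof.
move=> sp; elim: k => [|k IHk]; first by rewrite expr0; exact: (sosn 1).
by rewrite exprS; apply: sosM.
Qed.

Lemma sos_Xeven (i : 'I_n) k : sos ('X_i ^+ (2 * k)).
Proof. by rewrite exprM; apply/sosX/sos_sqr. Qed.

(** Since [(1 - p^d) (1 - p^e)] has the factor [(1 - p)^2], powers of a sum of
    squares are bounded by [1] plus any higher power. *)
Lemma sos_pow_gap p (d e : nat) : sos p -> sos (1 + p ^+ (d + e) - p ^+ d).
Proof.
move=> sp.
have -> : 1 + p ^+ (d + e) - p ^+ d = (p ^+ d - 1) * (p ^+ e - 1) + p ^+ e.
  by rewrite exprD; ring.
apply: sosD; last exact: sosX.
rewrite !subrX1 mulrACA -expr2; apply: sosM; first exact: sos_sqr.
by apply: sosM; apply: sos_sum => i _; apply: sosX.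
Qed.

Definition tail D : {mpoly R[n]} := 1 + \sum_(i < n) 'X_i ^+ (2 * D).

Lemma sos_tail D : sos (tail D).
Proof.
by apply: sosD; [exact: (sosn 1) | apply: sos_sum => i _; apply: sos_Xeven].
Qed.

(** The point is that the constant depends only on the number of variables,
    not on [D] and [D']. *)
Lemma tail_mono D D' : (D <= D')%N -> sos (n.+1%:R * tail D' - tail D).
Proof.
move=> /subnKC <-; move: (D' - D)%N => e; rewrite /tail.
set S := \sum_(i < n) 'X_i ^+ (2 * (D + e)).
have -> : n.+1%:R * (1 + S) - (1 + \sum_(i < n) 'X_i ^+ (2 * D)) =
    \sum_(i < n) (1 + ('X_i ^+ 2) ^+ (D + e) - ('X_i ^+ 2) ^+ D) +
    n%:R * S.
  rewrite sumrB big_split /= sumr_const card_ord.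
  under [X in n%:R + X - _ + _]eq_bigr do rewrite -exprM.
  under [X in _ - X + _]eq_bigr do rewrite -exprM.
  by rewrite -/S -natr1; ring.
apply: sosD; first by apply: sos_sum => i _; apply/sos_pow_gap/sos_sqr.
by apply: sosM; [exact: sosn | apply: sos_sum => i _; apply: sos_Xeven].
Qed.

(** Cauchy-Schwarz for the terms of [tail D], again with a constant that does
    not depend on [D]. *)
Lemma tail_sqr D : sos ((4 * n + 2)%:R * tail (2 * D) - tail D ^+ 2).
Proof.
rewrite /tail; pose a (i : 'I_n) : {mpoly R[n]} := 'X_i ^+ (2 * D).
under [X in 1 + X]eq_bigr => i _ do rewrite mulnC exprM -/(a i).
under [X in (1 + X) ^+ 2]eq_bigr => i _ do rewrite -/(a i).
set S2 := \sum_(i < n) a i ^+ 2; set S := \sum_(i < n) a i.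
have cs : \sum_(i < n) \sum_(j < n) ((a i - a j) ^+ 2 + a i * a j) =
    (2 * n)%:R * S2 - S ^+ 2.
  under eq_bigr => i _.
    have -> : \sum_(j < n) ((a i - a j) ^+ 2 + a i * a j) =
              n%:R * a i ^+ 2 + S2 - a i * S.
      under eq_bigr => j _.
        have -> : (a i - a j) ^+ 2 + a i * a j =
                  (a i ^+ 2 + a j ^+ 2) - a i * a j by ring.
        over.
      rewrite sumrB big_split /= sumr_const card_ord -mulr_sumr.
      by rewrite -/S2 -/S mulr_natl.
    over.
  rewrite sumrB big_split /= -mulr_sumr -mulr_suml sumr_const card_ord.
  by rewrite -/S -/S2 -mulr_natl natrM; ring.
have -> : (4 * n + 2)%:R * (1 + S2) - (1 + S) ^+ 2 =
    (1 - S) ^+ 2 + 2%:R * ((2 * n)%:R * S2 - S ^+ 2) +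
    (4 * n)%:R + 2%:R * S2.
  by rewrite natrD !natrM; ring.
have sa i : sos (a i) by apply: sos_Xeven.
rewrite -cs; apply: sosD; last first.
  by apply: sosM; [exact: sosn | apply: sos_sum => i _; exact: sos_sqr].
apply: sosD; last exact: sosn.
apply: sosD; first exact: sos_sqr.
apply: sosM; first exact: sosn.
apply: sos_sum => i _; apply: sos_sum => j _; apply: sosD; first exact: sos_sqr.
exact: sosM.
Qed.

(** Bounds that hold for every large exponent: the constant [c] is fixed before
    the degree, which makes it usable as a seminorm. *)
Definition tail_bounded c p := exists D0, forall D, (D0 <= D)%N ->
  sos (c%:MP * tail D - p) /\ sos (c%:MP * tail D + p).

Lemma tail_bounded_of D c p : 0 <= c ->
  sos (c%:MP * tail D - p) -> sos (c%:MP * tail D + p) ->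
  tail_bounded (c * n.+1%:R) p.
Proof.
move=> c0 sm sp; exists D => D' le_DD'.
have st : sos (c%:MP * (n.+1%:R * tail D' - tail D)).
  by apply: sosM; [exact: sosC | exact: tail_mono].
rewrite mpolyCM mpolyC_nat; split.
  suff -> : c%:MP * n.+1%:R * tail D' - p =
    c%:MP * (n.+1%:R * tail D' - tail D) + (c%:MP * tail D - p).
    exact: sosD.
  by ring.
suff -> : c%:MP * n.+1%:R * tail D' + p =
    c%:MP * (n.+1%:R * tail D' - tail D) + (c%:MP * tail D + p).
  exact: sosD.
by ring.
Qed.

Lemma tail_boundedC c : tail_bounded `|c| c%:MP.
Proof.
exists 0%N => D _; rewrite /tail; split.
  rewrite mulrDr mulr1 addrAC -mpolyCB; apply: sosD.
    by apply: sosC; rewrite subr_ge0 ler_norm.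
  apply: sosM; first exact: sosC.
  by apply: sos_sum => i _; apply: sos_Xeven.
rewrite mulrDr mulr1 addrAC -mpolyCD; apply: sosD.
  by apply: sosC; rewrite addrC -[c in c + _]opprK addrC subr_ge0 -normrN ler_norm.
apply: sosM; first exact: sosC.
by apply: sos_sum => i _; apply: sos_Xeven.
Qed.

Lemma tail_boundedD c c' p q : tail_bounded c p -> tail_bounded c' q ->
  tail_bounded (c + c') (p + q).
Proof.
move=> [D0 hp] [D1 hq]; exists (maxn D0 D1) => D.
rewrite geq_max => /andP[/hp[pm pp] /hq[qm qp]].
rewrite mpolyCD mulrDl; split; last by rewrite addrACA; apply: sosD.
by rewrite opprD addrACA; apply: sosD.
Qed.

(** The identity behind [|pq| <= uv] whenever [|p| <= u] and [|q| <= v] in an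
    order given by a cone stable under sums and products. *)
Lemma mul_gap p q u v : u * v - p * q =
  2%:R^-1%:MP * ((u - p) * (v + q) + (u + p) * (v - q)) :> {mpoly R[n]}.
Proof.
have -> : (u - p) * (v + q) + (u + p) * (v - q) = 2%:R * (u * v - p * q) by ring.
by rewrite mulrA mpoly_half mul1r.
Qed.

Lemma sos_mul_gap p q u v : sos (u - p) -> sos (u + p) ->
  sos (v - q) -> sos (v + q) -> sos (u * v - p * q).
Proof.
move=> um up vm vp; rewrite mul_gap; apply: sosM; first by apply: sosC; rewrite invr_ge0.
by apply: sosD; apply: sosM.
Qed.

Lemma tail_boundedM c c' p q : 0 <= c -> 0 <= c' ->
  tail_bounded c p -> tail_bounded c' q ->
  tail_bounded (c * c' * (4 * n + 2)%:R * n.+1%:R) (p * q).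
Proof.
move=> c0 c'0 [D0 hp] [D1 hq].
have [pm pp] := hp _ (leq_maxl D0 D1).
have [qm qp] := hq _ (leq_maxr D0 D1).
move: (maxn D0 D1) pm pp qm qp => D pm pp qm qp.
have key (r : {mpoly R[n]}) : sos (c%:MP * tail D * (c'%:MP * tail D) - r) ->
    sos ((c * c' * (4 * n + 2)%:R)%:MP * tail (2 * D) - r).
  move=> sr; rewrite !mpolyCM mpolyC_nat.
  have -> : c%:MP * c'%:MP * (4 * n + 2)%:R * tail (2 * D) - r =
    c%:MP * c'%:MP * ((4 * n + 2)%:R * tail (2 * D) - tail D ^+ 2) +
    (c%:MP * tail D * (c'%:MP * tail D) - r) by ring.
  apply: sosD => //; apply: sosM; last exact: tail_sqr.
  by apply: sosM; apply: sosC.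
apply: (@tail_bounded_of (2 * D)); first by rewrite !mulr_ge0.
  by apply: key; apply: sos_mul_gap.
rewrite -[p * q]opprK -mulrN; apply: key; apply: sos_mul_gap => //.
by rewrite opprK.
Qed.

Lemma tail_bounded_ex p : exists2 c, 0 <= c & tail_bounded c p.
Proof.
elim/mpoly_ring_ind: p => [c|i|p q [c c0 hp] [c' c'0 hq]|p q [c c0 hp] [c' c'0 hq]].
- by exists `|c|; [exact: normr_ge0 | exact: tail_boundedC].
- have sX : sos (\sum_(j < n | j != i) 'X_j ^+ (2 * 1)).
    by apply: sos_sum => j _; apply: sos_Xeven.
  have st (s : R) : s ^+ 2 = 1 ->
      sos (1%:MP * tail 1 + s%:MP * 'X_i : {mpoly R[n]}).
    move=> s1; rewrite mpolyC1 mul1r /tail (bigD1 i) //= muln1.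
    set Y := \sum_(j < n | _) _ in sX *.
    have -> : 1 + ('X_i ^+ 2 + Y) + s%:MP * 'X_i =
      (3%:R / 4%:R)%:MP + ('X_i + (s / 2%:R)%:MP) ^+ 2 + Y.
      set z := (s / 2%:R)%:MP.
      have -> : s%:MP = z * 2%:R :> {mpoly R[n]}.
        by rewrite -mpolyC_nat -mpolyCM divfK ?pnatr_eq0.
      have one : 1 = (3%:R / 4%:R)%:MP + z ^+ 2 :> {mpoly R[n]}.
        rewrite -rmorphXn /= expr_div_n s1 -mpolyCD -[LHS]mpolyC1.
        by congr (_%:MP); field.
      by rewrite {1}one; ring.
    apply: sosD => //; apply: sosD; last exact: sos_sqr.
    by apply: sosC; rewrite divr_ge0.
  exists (1 * n.+1%:R); first by rewrite mulr_ge0.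
  apply: (@tail_bounded_of 1) => //.
    by have := st (-1); rewrite mpolyCN mpolyC1 mulN1r; apply; rewrite sqrrN expr1n.
  by have := st 1; rewrite mpolyC1 mul1r mul1r; apply; rewrite expr1n.
- by exists (c + c'); [exact: addr_ge0 | exact: tail_boundedD].
by eexists; last exact: (tail_boundedM c0 c'0 hp hq); rewrite !mulr_ge0.
Qed.

(** * Polynomials that are sums of squares up to a small tail *)

Definition approx_sos p := forall e, 0 < e -> exists D0, forall D, (D0 <= D)%N ->
  sos (p + e%:MP * tail D).

(** By [tail_mono] a single exponent for each [e] suffices. *)
Lemma approx_sosW p :
  (forall e, 0 < e -> exists D, sos (p + e%:MP * tail D)) -> approx_sos p.
Proof.
move=> h e e0; have e'0 : 0 < e / n.+1%:R by rewrite divr_gt0 ?ltr0n.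
have [D sD] := h _ e'0; exists D => D' le_DD'.
have -> : e%:MP = (e / n.+1%:R)%:MP * n.+1%:R :> {mpoly R[n]}.
  by rewrite -mpolyC_nat -mpolyCM divfK ?pnatr_eq0.
move: (e / _) e'0 sD => e' e'0 sD.
have -> : p + e'%:MP * n.+1%:R * tail D' =
  (p + e'%:MP * tail D) + e'%:MP * (n.+1%:R * tail D' - tail D) by ring.
by apply: sosD => //; apply: sosM; [apply/sosC/ltW | exact: tail_mono].
Qed.

Lemma approx_sos_sos p : sos p -> approx_sos p.
Proof.
move=> sp e e0; exists 0%N => D _; apply: sosD => //.
by apply: sosM; [apply/sosC/ltW | exact: sos_tail].
Qed.

Lemma approx_sosC c : 0 <= c -> approx_sos c%:MP.
Proof. by move=> c0; apply/approx_sos_sos/sosC. Qed.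

Lemma approx_sosD p q : approx_sos p -> approx_sos q -> approx_sos (p + q).
Proof.
move=> hp hq e e0; have e2 : 0 < e / 2%:R by rewrite divr_gt0.
have [[D0 sp] [D1 sq]] := (hp _ e2, hq _ e2).
exists (maxn D0 D1) => D; rewrite geq_max => /andP[/sp {}sp /sq {}sq].
have -> : e%:MP = (e / 2%:R)%:MP + (e / 2%:R)%:MP :> {mpoly R[n]}.
  by rewrite -mpolyCD -splitr.
by rewrite mulrDl addrACA; apply: sosD.
Qed.

Lemma approx_sos_sum (I : Type) (r : seq I) (P : pred I)
    (F : I -> {mpoly R[n]}) :
  (forall i, P i -> approx_sos (F i)) -> approx_sos (\sum_(i <- r | P i) F i).
Proof.
move=> h; apply: big_ind => //; last exact: approx_sosD.
exact/approx_sos_sos/sos0.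
Qed.

Lemma approx_sos_closed p :
  (forall e, 0 < e -> approx_sos (p + e%:MP)) -> approx_sos p.
Proof.
move=> h e e0; have e2 : 0 < e / 2%:R by rewrite divr_gt0.
have [D0 sp] := h _ e2 _ e2; exists D0 => D /sp {}sp.
have -> : e%:MP = (e / 2%:R)%:MP + (e / 2%:R)%:MP :> {mpoly R[n]}.
  by rewrite -mpolyCD -splitr.
have -> : p + ((e / 2%:R)%:MP + (e / 2%:R)%:MP) * tail D =
  p + (e / 2%:R)%:MP + (e / 2%:R)%:MP * tail D +
  (e / 2%:R)%:MP * \sum_(i < n) 'X_i ^+ (2 * D) by rewrite /tail; ring.
apply: sosD => //; apply: sosM; first exact/sosC/ltW.
by apply: sos_sum => i _; apply: sos_Xeven.
Qed.

Lemma tail_bounded_tail D : tail_bounded (n.+1%:R) (tail D).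
Proof.
rewrite -[n.+1%:R]mul1r; apply: (@tail_bounded_of D) => //.
  by rewrite mpolyC1 mul1r subrr; exact: sos0.
by rewrite mpolyC1 mul1r; apply: sosD; exact: sos_tail.
Qed.

(** Multiply [p + d * tail D] by [q + d * tail D].  The unwanted terms
    [d * tail D * (p + q)] and [d^2 * (tail D)^2] are bounded by [d * K1] and
    [d^2 * K2] times a tail of higher exponent, where [K1] and [K2] are known
    before [d] and [D] are chosen; so [d] can be taken small compared with
    them. *)
Lemma approx_sosM p q : approx_sos p -> approx_sos q -> approx_sos (p * q).
Proof.
move=> hp hq; have [a a0 ha] := tail_bounded_ex (p + q).
apply: approx_sosW => e e0.
pose t := n.+1%:R : R.
pose kap : R := (4 * n + 2)%:R.
pose K1 := t * a * kap * t; pose K2 := t * t * kap * t.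
have K10 : 0 <= K1 by rewrite !mulr_ge0.
have K20 : 0 <= K2 by rewrite !mulr_ge0.
have den : 0 < e + (K1 + K2) by rewrite ltr_wpDr // addr_ge0.
(* This choice gives both d <= 1 and d * (K1 + K2) <= e. *)
pose d := e / (e + (K1 + K2)).
have d0 : 0 < d by rewrite divr_gt0.
have d1 : d <= 1 by rewrite ler_pdivrMr // mul1r lerDl addr_ge0.
have dK : d * (K1 + K2) <= e.
  rewrite mulrAC ler_pdivrMr // ler_pM2l // lerDr; exact: ltW.
have [[D0 sp] [D1 sq]] := (hp _ d0, hq _ d0).
have := sp _ (leq_maxl D0 D1); have := sq _ (leq_maxr D0 D1).
move: (maxn D0 D1) => D {}sq {}sp.
have t0 : 0 <= t by [].
have [D2 h1] := tail_boundedM t0 a0 (tail_bounded_tail D) ha.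
have [D3 h2] := tail_boundedM t0 t0 (tail_bounded_tail D) (tail_bounded_tail D).
have [s1 _] := h1 _ (leq_maxl D2 D3); have [s2 _] := h2 _ (leq_maxr D2 D3).
exists (maxn D2 D3); move: (maxn D2 D3) s1 s2 => D' s1 s2 {h1 h2}.
rewrite -/kap -/t -/K1 -/K2 in s1 s2.
have se : sos ((e - d * K1 - d ^+ 2 * K2)%:MP * tail D').
  apply: sosM; last exact: sos_tail.
  apply: sosC; rewrite -addrA -opprD subr_ge0; apply: le_trans dK.
  rewrite mulrDr lerD2l ler_wpM2r // expr2 ler_piMl //; exact: ltW.
have -> : p * q + e%:MP * tail D' =
  (p + d%:MP * tail D) * (q + d%:MP * tail D) +
  d%:MP * (K1%:MP * tail D' - tail D * (p + q)) +
  d%:MP ^+ 2 * (K2%:MP * tail D' - tail D * tail D) +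
  (e - d * K1 - d ^+ 2 * K2)%:MP * tail D'.
  by rewrite !mpolyCB !mpolyCM ?rmorphXn /=; ring.
have sd : sos (d%:MP_[n]) by apply: sosC; exact: ltW.
apply: sosD => //; apply: sosD; last by apply: sosM => //; apply: sosX.
by apply: sosD; apply: sosM.
Qed.

(** Iterating [1 - u = (1 - u)^2 / 2 + (1 - u^2) / 2] replaces [u] by higher and
    higher powers with halving weights. *)
Lemma sos_dyadic u k :
  sos (1 - u + (2%:R ^- k)%:MP * (u ^+ (2 ^ k) - 1)).
Proof.
have half := mpoly_half.
have sh : sos (2%:R^-1%:MP_[n] : {mpoly R[n]}) by apply: sosC; rewrite invr_ge0.
elim: k u => [|k IHk] u.
  rewrite expr0 invr1 mpolyC1 expn0 expr1.
  have -> : 1 - u + 1 * (u - 1) = 0 by ring.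
  exact: sos0.
rewrite expnS exprM exprS invfM mpolyCM.
have := IHk (u ^+ 2); move: (_ ^+ (2 ^ k)) (2%:R ^- k) => y a s.
have -> : 1 - u + 2%:R^-1%:MP * a%:MP * (y - 1) =
  2%:R^-1%:MP * ((1 - u) ^+ 2 + (1 - u ^+ 2 + a%:MP * (y - 1))).
  set h := 2%:R^-1%:MP in half *.
  have {1}-> : 1 - u = (h * 2%:R) * (1 - u) by rewrite half mul1r.
  by ring.
by apply: sosM => //; apply: sosD => //; apply: sos_sqr.
Qed.

Lemma exp2_small e : 0 < e -> exists k, 2%:R ^- k.+1 <= e.
Proof.
move=> e0; exists (Num.bound e^-1).
rewrite -[leRHS]invrK lef_pV2 ?posrE ?invr_gt0 ?exprn_gt0 //.
apply/ltW/(lt_trans (archi_boundP _)); first by rewrite invr_ge0 ltW.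
by rewrite -natrX ltr_nat (ltn_trans (ltnSn _)) // ltn_expl.
Qed.

(** For [s = 1] and [s = -1]: the only place where the box enters the cone. *)
Lemma approx_sos_1X (s : R) (i : 'I_n) : s ^+ 2 = 1 ->
  approx_sos (1 - s%:MP * 'X_i).
Proof.
move=> s1; apply: approx_sosW => e e0.
have [k ke] := exp2_small e0.
exists (2 ^ k)%N; have := sos_dyadic (s%:MP * 'X_i) k.+1.
have sE : s%:MP ^+ (2 * 2 ^ k) = 1 :> {mpoly R[n]}.
  by rewrite -rmorphXn /= exprM s1 expr1n mpolyC1.
rewrite exprMn expnS sE mul1r.
set a := 2%:R ^- _ in ke *; set T := tail _; set Y := 'X_i ^+ _ => sk.
have sTY : sos (T - Y).
  rewrite /T /tail (bigD1 i) //= -/Y [Y + _]addrC addrA addrK.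
  apply: sosD; first exact: (sosn 1).
  by apply: sos_sum => j _; apply: sos_Xeven.
have a0 : 0 <= a by rewrite invr_ge0 exprn_ge0.
have -> : 1 - s%:MP * 'X_i + e%:MP * T =
  (1 - s%:MP * 'X_i + a%:MP * (Y - 1)) + a%:MP * ((T - Y) + 1)
    + (e - a)%:MP * T by rewrite mpolyCB; ring.
apply: sosD; last by apply: sosM; [apply: sosC; rewrite subr_ge0 | exact: sos_tail].
apply: sosD => //; apply: sosM; first exact: sosC.
by apply: sosD => //; exact: (sosn 1).
Qed.

(** [|p| <= u] in the order defined by the cone. *)
Definition dominated u p := approx_sos (u - p) /\ approx_sos (u + p).

Lemma dominatedC a c : `|c| <= a -> dominated a%:MP c%:MP.
Proof.
rewrite ler_norml => /andP[h1 h2].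
split; rewrite -?mpolyCB -?mpolyCD; apply: approx_sosC; rewrite ?subr_ge0 //.
by rewrite addrC -lerBlDr sub0r.
Qed.

Lemma dominatedX i : dominated 1 'X_i.
Proof.
split.
  by have := @approx_sos_1X 1 i; rewrite mpolyC1 mul1r; apply; rewrite expr1n.
have := @approx_sos_1X (-1) i; rewrite mpolyCN mpolyC1 mulN1r opprK; apply.
by rewrite sqrrN expr1n.
Qed.

Lemma dominatedD u v p q :
  dominated u p -> dominated v q -> dominated (u + v) (p + q).
Proof.
move=> [um up] [vm vp]; split; last by rewrite addrACA; apply: approx_sosD.
by rewrite opprD addrACA; apply: approx_sosD.
Qed.

Lemma dominated_sum (I : Type) (r : seq I) (u p : I -> {mpoly R[n]}) :
  (forall i, dominated (u i) (p i)) ->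
  dominated (\sum_(i <- r) u i) (\sum_(i <- r) p i).
Proof.
by move=> h; split; rewrite -?sumrB -?big_split;
  apply: approx_sos_sum => i _; case: (h i).
Qed.

Lemma dominatedN u p : dominated u p -> dominated u (- p).
Proof. by move=> [um up]; split; rewrite ?opprK. Qed.

Lemma dominatedM u v p q :
  dominated u p -> dominated v q -> dominated (u * v) (p * q).
Proof.
have gap (a b : {mpoly R[n]}) :
    dominated u a -> dominated v b -> approx_sos (u * v - a * b).
  move=> [um up] [vm vp]; rewrite mul_gap; apply: approx_sosM.
    by apply: approx_sosC; rewrite invr_ge0.
  by apply: approx_sosD; apply: approx_sosM.
move=> up vq; split; first exact: gap.
by rewrite -[p * q]opprK -mulNr; apply: gap => //; apply: dominatedN.
Qed.

Lemma dominated_id p : approx_sos p -> dominated p p.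
Proof.
move=> gp; split; last exact: approx_sosD.
by rewrite subrr; apply/approx_sos_sos/sos0.
Qed.

Lemma dominatedW u v p : approx_sos (v - u) -> dominated u p -> dominated v p.
Proof.
move=> vu [um up]; rewrite -[v](subrK u).
by split; rewrite -addrA; apply: approx_sosD.
Qed.

Lemma dominated_const_ex p : exists2 c, 0 <= c & dominated c%:MP p.
Proof.
elim/mpoly_ring_ind: p => [c|i|p q [c c0 hp] [d d0 hq]|p q [c c0 hp] [d d0 hq]].
- by exists `|c|; [exact: normr_ge0 | exact: dominatedC].
- by exists 1 => //; rewrite mpolyC1; exact: dominatedX.
- by exists (c + d); [exact: addr_ge0 | rewrite mpolyCD; exact: dominatedD].
- by exists (c * d); [exact: mulr_ge0 | rewrite mpolyCM; exact: dominatedM].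
Qed.

Lemma meval_box_bounded p :
  exists2 c, 0 <= c & forall z, in_box z -> `|p.@[z]| <= c.
Proof.
elim/mpoly_ring_ind: p => [c|i|p q [c c0 hp] [d d0 hq]|p q [c c0 hp] [d d0 hq]].
- by exists `|c|; [exact: normr_ge0 | move=> z _; rewrite mevalC].
- by exists 1 => // z hz; rewrite mevalXU ler_norml; apply: hz.
- exists (c + d); first exact: addr_ge0.
  move=> z hz; rewrite mevalD (le_trans (ler_normD _ _)) //.
  by apply: lerD; [exact: hp | exact: hq].
- exists (c * d); first exact: mulr_ge0.
  move=> z hz; rewrite mevalM normrM.
  by apply: ler_pM => //; [exact: hp | exact: hq].
Qed.

Definition sqdist (z : 'I_n -> R) : {mpoly R[n]} :=
  \sum_(i < n) ('X_i - (z i)%:MP) ^+ 2.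

(** Continuity at [z], uniformly in [z]: near [z] the oscillation of [p] is at
    most [e], and away from [z] it is absorbed by a multiple of the squared
    distance.  For a coordinate this is
    [|w| <= e + w^2 / (4 e)]; sums and products follow the usual
    epsilon-management. *)
Lemma dominated_oscillation p e : 0 < e -> exists2 K, 0 <= K &
  forall z, in_box z -> dominated (e%:MP + K%:MP * sqdist z) (p - p.@[z]%:MP).
Proof.
move=> e0.
elim/mpoly_ring_ind: p e e0 => [c|i|p q IHp IHq|p q IHp IHq] e e0.
- exists 0 => // z _; rewrite mevalC subrr mpolyC0 mul0r addr0 -mpolyC0.
  by apply: dominatedC; rewrite normr0 ltW.
- have d0 : 0 < (2%:R * e)^-1 by rewrite invr_gt0 mulr_gt0.
  have K0 : 0 <= e * (2%:R * e)^-1 ^+ 2 by rewrite mulr_ge0 ?sqr_ge0 // ltW.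
  exists (e * (2%:R * e)^-1 ^+ 2) => // z _.
  rewrite mevalXU /sqdist (bigD1 i) //=; set Z := \sum_(j < n | _) _.
  have sZ : sos Z by apply: sos_sum => j _; apply: sos_sqr.
  have st (s : R) : s ^+ 2 = 1 ->
     approx_sos (e%:MP + (e * (2%:R * e)^-1 ^+ 2)%:MP *
        (('X_i - (z i)%:MP) ^+ 2 + Z) + s%:MP * ('X_i - (z i)%:MP)).
    move=> s1; apply: approx_sos_sos; set w := 'X_i - _.
    have -> : e%:MP + (e * (2%:R * e)^-1 ^+ 2)%:MP * (w ^+ 2 + Z) + s%:MP * w =
        e%:MP * (s%:MP + (2%:R * e)^-1%:MP * w) ^+ 2 +
        (e * (2%:R * e)^-1 ^+ 2)%:MP * Z.
      have se : s%:MP = s%:MP * (2%:R * e%:MP * (2%:R * e)^-1%:MP) :> {mpoly R[n]}.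
        rewrite -mpolyC_nat -!mpolyCM divff ?mulr1 //.
        by rewrite mulf_neq0 ?pnatr_eq0 ?gt_eqF.
      have s2 : s%:MP ^+ 2 = 1 :> {mpoly R[n]} by rewrite -rmorphXn /= s1 mpolyC1.
      rewrite !mpolyCM ?rmorphXn /=.
      set E := e%:MP; set S := s%:MP in se s2 *; set g := _^-1%:MP in se *.
      have -> : E * (S + g * w) ^+ 2 =
        E * S ^+ 2 + S * (2%:R * E * g) * w + E * g ^+ 2 * w ^+ 2 by ring.
      by rewrite s2 -se; ring.
    apply: sosD; apply: sosM => //; try exact: sosC.
      exact/sosC/ltW.
    exact: sos_sqr.
  split.
    by have := st (-1); rewrite mpolyCN mpolyC1 mulN1r; apply; rewrite sqrrN expr1n.
  by have := st 1; rewrite mpolyC1 mul1r; apply; rewrite expr1n.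
- have e2 : 0 < e / 2%:R by rewrite divr_gt0.
  have [[K K0 hp] [L L0 hq]] := (IHp _ e2, IHq _ e2).
  exists (K + L); first exact: addr_ge0.
  move=> z hz; rewrite mevalD [e]splitr !mpolyCD mulrDl opprD.
  rewrite [X in dominated X _]addrACA [X in dominated _ X]addrACA.
  by apply: dominatedD; [exact: hp | exact: hq].
have [c c0 hc] := dominated_const_ex q.
have [d d0 hd] := meval_box_bounded p.
have c1 : 0 < 2%:R * (c + 1) by rewrite mulr_gt0 // ltr_wpDl.
have d1 : 0 < 2%:R * (d + 1) by rewrite mulr_gt0 // ltr_wpDl.
have [K K0 hp] := IHp _ (divr_gt0 e0 c1).
have [L L0 hq] := IHq _ (divr_gt0 e0 d1).
exists (K * c + d * L); first by rewrite addr_ge0 ?mulr_ge0.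
move=> z hz; rewrite mevalM.
have -> : p * q - (p.@[z] * q.@[z])%:MP =
  (p - p.@[z]%:MP) * q + p.@[z]%:MP * (q - q.@[z]%:MP).
  by rewrite mpolyCM; ring.
pose e1 := e / (2%:R * (c + 1)); pose e2 := e / (2%:R * (d + 1)).
apply: (@dominatedW ((e1%:MP + K%:MP * sqdist z) * c%:MP +
                     d%:MP * (e2%:MP + L%:MP * sqdist z))).
  have -> : e%:MP + (K * c + d * L)%:MP * sqdist z -
      ((e1%:MP + K%:MP * sqdist z) * c%:MP +
       d%:MP * (e2%:MP + L%:MP * sqdist z)) = (e - e1 * c - d * e2)%:MP.
    by rewrite !mpolyCD !mpolyCN !mpolyCM; ring.
  have h (a : R) : 0 <= a -> e / (2%:R * (a + 1)) * a <= e / 2%:R.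
    move=> a0; rewrite mulrAC invfM mulrA ler_pdivrMr; last by rewrite ltr_wpDl.
    by rewrite mulrAC ler_pM2l ?divr_gt0 // lerDl.
  apply: approx_sosC; rewrite -addrA -opprD subr_ge0 [leRHS]splitr.
  by apply: lerD; [exact: h | rewrite mulrC; exact: h].
by apply: dominatedD; apply: dominatedM; [exact: hp| |apply/dominatedC/hd | exact: hq].
Qed.

(** * Positive quadratures with small variance *)

(** The nodes [z k] with weights [b k] form, over each point [x] of the box, a
    probability distribution of mean [x] whose variance in every coordinate is
    [e * (1 - x_i^2)]. *)
Definition quadrature (K : finType) (b : K -> {mpoly R[n]})
    (z : K -> 'I_n -> R) (e : R) :=
  [/\ forall k, approx_sos (b k), forall k, in_box (z k), \sum_k b k = 1,
      forall i, \sum_k b k * (z k i)%:MP = 'X_i &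
      forall i, \sum_k b k * ('X_i - (z k i)%:MP) ^+ 2 =
                e%:MP * (1 - 'X_i ^+ 2)].

(** Independent signs: the vertex [s] of the box gets the weight
    [prod_i (1 + s_i x_i) / 2]. *)
Lemma quadrature_vertices : exists (K : finType) b z, @quadrature K b z 1.
Proof.
pose sg (s : bool) : R := if s then 1 else -1.
pose F (i : 'I_n) s : {mpoly R[n]} := 2%:R^-1%:MP * (1 + (sg s)%:MP * 'X_i).
pose b (f : {ffun 'I_n -> bool}) := \prod_i F i (f i).
have F1 i : F i true + F i false = 1.
  rewrite /F /sg mpolyCN mpolyC1 -mulrDr.
  have -> : 1 + 1 * 'X_i + (1 + -1 * 'X_i) = 2%:R :> {mpoly R[n]} by ring.
  exact: mpoly_half.
have moment i (w : bool -> {mpoly R[n]}) :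
    \sum_f b f * w (f i) = F i true * w true + F i false * w false.
  pose G j s := F j s * (if j == i then w s else 1).
  transitivity (\sum_(f : {ffun 'I_n -> bool}) \prod_j G j (f j)).
    apply: eq_bigr => f _; rewrite /G big_split /=; congr (_ * _).
    by rewrite -big_mkcond big_pred1_eq.
  rewrite -bigA_distr_bigA (bigD1 i) //= big_bool /G eqxx.
  rewrite [X in _ * X]big1 ?mulr1 // => j /negPf ji.
  by rewrite big_bool /= ji !mulr1 F1.
exists {ffun 'I_n -> bool}, b, (fun (f : {ffun _}) i => sg (f i)); split.
- move=> f; apply: big_ind; first by rewrite -mpolyC1; apply: approx_sosC.
    exact: approx_sosM.
  move=> i _; apply: approx_sosM; first by apply: approx_sosC; rewrite invr_ge0.
  have -> : (sg (f i))%:MP = - (- sg (f i))%:MP :> {mpoly R[n]}.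
    by rewrite mpolyCN opprK.
  rewrite mulNr; apply: approx_sos_1X; rewrite sqrrN /sg.
  by case: (f i); rewrite ?sqrrN expr1n.
- by move=> f i; rewrite /sg; case: (f i); rewrite !lexx ?andbT //= -subr_ge0 opprK addr_ge0.
- by rewrite -(bigA_distr_bigA F) big1 // => i _; rewrite big_bool; exact: F1.
- move=> i; rewrite (moment i (fun s => (sg s)%:MP)) /F /sg mpolyCN mpolyC1.
  rewrite -[RHS]mul1r -[X in _ = X * _]mpoly_half; ring.
move=> i; rewrite (moment i (fun s => ('X_i - (sg s)%:MP) ^+ 2)) /F /sg.
rewrite mpolyCN mpolyC1 -[X in X * (1 - _)]mpoly_half; ring.
Qed.

(** The midpoint of two independent copies of a random point has the same mean
    and half the variance. *)
Lemma quadrature_halve (K : finType) b z e : @quadrature K b z e ->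
  exists (K' : finType) b' z', @quadrature K' b' z' (e / 2%:R).
Proof.
case=> bpos zbox b1 bz bv.
exists (K * K)%type, (fun k => b k.1 * b k.2),
  (fun k i => (z k.1 i + z k.2 i) / 2%:R).
have sum2 (f g : K -> {mpoly R[n]}) :
    \sum_(k : K * K) f k.1 * g k.2 = (\sum_k f k) * \sum_k g k.
  by rewrite big_distrlr pair_bigA.
have avg (x y : R) : ((x + y) / 2%:R)%:MP = (x%:MP + y%:MP) * 2%:R^-1%:MP
    :> {mpoly R[n]} by rewrite mpolyCM mpolyCD.
have dev i : \sum_k b k * ('X_i - (z k i)%:MP) = 0.
  under eq_bigr do rewrite mulrBr.
  by rewrite sumrB -mulr_suml b1 bz mul1r subrr.
split.
- by move=> k; apply: approx_sosM.
- move=> k i; have /andP[l1 r1] := zbox k.1 i; have /andP[l2 r2] := zbox k.2 i.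
  rewrite ler_pdivlMr // ler_pdivrMr // mulN1r mul1r -[2%:R]/(1 + 1) opprD.
  by rewrite !lerD.
- by rewrite sum2 b1 mulr1.
- move=> i.
  under eq_bigr => k _.
    rewrite avg.
    have -> : b k.1 * b k.2 * (((z k.1 i)%:MP + (z k.2 i)%:MP) * 2%:R^-1%:MP) =
      2%:R^-1%:MP * ((b k.1 * (z k.1 i)%:MP) * b k.2 +
                     b k.1 * (b k.2 * (z k.2 i)%:MP)) by ring.
    over.
  rewrite -mulr_sumr big_split /= (sum2 (fun k => b k * (z k i)%:MP)).
  rewrite (sum2 _ (fun k => b k * (z k i)%:MP)) b1 bz mul1r mulr1.
  by rewrite -[RHS]mul1r -[X in _ = X * _]mpoly_half; ring.
move=> i.
under eq_bigr => k _.
  rewrite avg.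
  have -> : b k.1 * b k.2 *
      ('X_i - ((z k.1 i)%:MP + (z k.2 i)%:MP) * 2%:R^-1%:MP) ^+ 2 =
    2%:R^-1%:MP ^+ 2 * ((b k.1 * ('X_i - (z k.1 i)%:MP) ^+ 2) * b k.2 +
      b k.1 * (b k.2 * ('X_i - (z k.2 i)%:MP) ^+ 2) +
      2%:R * (b k.1 * ('X_i - (z k.1 i)%:MP) * (b k.2 * ('X_i - (z k.2 i)%:MP)))).
    have -> : 'X_i - ((z k.1 i)%:MP + (z k.2 i)%:MP) * 2%:R^-1%:MP =
      2%:R^-1%:MP * (('X_i - (z k.1 i)%:MP) + ('X_i - (z k.2 i)%:MP)).
      by rewrite -{1}['X_i]mul1r -[X in X * 'X_i - _]mpoly_half; ring.
    by ring.
  over.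
rewrite -mulr_sumr !big_split /= -mulr_sumr.
rewrite (sum2 (fun k => b k * ('X_i - (z k i)%:MP) ^+ 2)).
rewrite (sum2 _ (fun k => b k * ('X_i - (z k i)%:MP) ^+ 2)).
rewrite (sum2 (fun k => b k * ('X_i - (z k i)%:MP)) (fun k => b k * ('X_i - (z k i)%:MP))).
rewrite b1 bv dev mpolyCM mul0r mulr0 addr0 mul1r mulr1 -mulr2n.
move: mpoly_half; set h := _%:MP => hh.
by rewrite -[X in _ = _ * X * _]mulr1 -[X in _ = _ * (_ * X) * _]hh; ring.
Qed.

Lemma quadrature_ex e : 0 < e -> exists (K : finType) b z d,
  [/\ 0 <= d, d <= e & @quadrature K b z d].
Proof.
move=> e0.
have [k] := exp2_small e0; move: k.+1 => m me.
suff [K [b [z h]]] : exists (K : finType) b z, @quadrature K b z (2%:R ^- m).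
  by exists K, b, z, (2%:R ^- m); split=> //; rewrite invr_ge0 exprn_ge0.
elim: m {me} => [|m [K [b [z h]]]].
  by rewrite expr0 invr1; exact: quadrature_vertices.
by rewrite exprSr invfM; exact: quadrature_halve h.
Qed.

(** One quadrature serves finitely many polynomials at once, as is needed for
    the entries of a matrix. *)
Lemma quadrature_approx (I : finType) (h : I -> {mpoly R[n]}) e : 0 < e ->
  exists (K : finType) b z d, @quadrature K b z d /\
    forall i, dominated e%:MP (h i - \sum_k b k * ((h i).@[z k])%:MP).
Proof.
move=> e0; have e2 : 0 < e / 2%:R by rewrite divr_gt0.
have /fin_all_exists[C hC] : forall i, exists C, 0 <= C /\ forall z, in_box z ->
    dominated ((e / 2%:R)%:MP + C%:MP * sqdist z) (h i - (h i).@[z]%:MP).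
  by move=> i; have [C C0 hC] := dominated_oscillation (h i) e2; exists C.
pose C' := \sum_i C i + 1.
have S0 : 0 <= \sum_i C i by apply: sumr_ge0 => i _; case: (hC i).
have C'0 : 0 < C' * n.+1%:R by rewrite mulr_gt0 // ltr_wpDl.
have [K [b [z [d [d0 de q]]]]] := quadrature_ex (divr_gt0 e2 C'0).
exists K, b, z, d; split=> // i.
have [bpos zbox b1 _ bv] := q; have [Ci0 hi] := hC i.
have -> : h i - \sum_k b k * ((h i).@[z k])%:MP =
  \sum_k b k * (h i - ((h i).@[z k])%:MP).
  under [RHS]eq_bigr do rewrite mulrBr.
  by rewrite sumrB -mulr_suml b1 mul1r.
apply: (@dominatedW
  (\sum_k b k * ((e / 2%:R)%:MP + (C i)%:MP * sqdist (z k)))); last first.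
  by apply: dominated_sum => k; apply: dominatedM; [exact: dominated_id | exact: hi].
have -> : \sum_k b k * ((e / 2%:R)%:MP + (C i)%:MP * sqdist (z k)) =
  (e / 2%:R)%:MP + (C i)%:MP * (d%:MP * (n%:R - \sum_(j < n) 'X_j ^+ 2)).
  under eq_bigr do rewrite mulrDr mulrCA.
  rewrite big_split /= -mulr_suml b1 mul1r -mulr_sumr; congr (_ + _ * _).
  rewrite /sqdist; under [LHS]eq_bigr do rewrite mulr_sumr.
  rewrite exchange_big /=; under [LHS]eq_bigr do rewrite bv.
  by rewrite -mulr_sumr sumrB sumr_const card_ord.
have Ci_le : C i <= C'.
  rewrite /C' (bigD1 i) //= -addrA lerDl addr_ge0 // sumr_ge0 // => j _.
  by case: (hC j).
have small : C i * d * n%:R <= e / 2%:R.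
  apply: (@le_trans _ _ (C' * (e / 2%:R / (C' * n.+1%:R)) * n.+1%:R)).
    apply: ler_pM; rewrite ?mulr_ge0 ?ler_nat //.
    by apply: ler_pM.
  by rewrite [C' * (_ / _)]mulrC -mulrA divfK ?gt_eqF.
have -> : e%:MP - ((e / 2%:R)%:MP +
    (C i)%:MP * (d%:MP * (n%:R - \sum_(j < n) 'X_j ^+ 2))) =
  (e / 2%:R - C i * d * n%:R)%:MP +
  (C i * d)%:MP * \sum_(j < n) 'X_j ^+ 2 :> {mpoly R[n]}.
  by rewrite [X in X%:MP - _]splitr mpolyCD mpolyCB !mpolyCM mpolyC_nat; ring.
apply: approx_sosD; first by apply: approx_sosC; rewrite subr_ge0.
apply/approx_sos_sos/sosM; first by apply: sosC; rewrite mulr_ge0.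
by apply: sos_sum => j _; apply: sos_sqr.
Qed.
End Sos.

(** * Real positive semidefinite matrices *)

Section Gram.
Variables (R : realType) (t : nat).
Implicit Types (A : 'M[R]_t) (y : 'cV[R]_t).

Definition bform A (x y : 'cV[R]_t) : R := (x^T *m A *m y) 0 0.

Lemma bformE A x y : bform A x y = \sum_i \sum_j x i 0 * A i j * y j 0.
Proof.
rewrite /bform mxE exchange_big; apply: eq_bigr => j _.
rewrite mxE mulr_suml; apply: eq_bigr => i _.
by rewrite !mxE.
Qed.

Definition psd A := forall y, 0 <= bform A y y.

Lemma outerE (S : comNzRingType) (v : 'rV[S]_t) i j :
  (v^T *m v) i j = v 0 i * v 0 j.
Proof. by rewrite !mxE big_ord1 !mxE. Qed.

Lemma bform_line A x z k :
  bform A (x + k *: z) (x + k *: z) =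
  bform A x x + k * (bform A x z + bform A z x) + k ^+ 2 * bform A z z.
Proof.
have addE (P Q : 'M[R]_1) : (P + Q) 0 0 = P 0 0 + Q 0 0 by rewrite mxE.
have scaleE c (P : 'M[R]_1) : (c *: P) 0 0 = c * P 0 0 by rewrite mxE.
have -> : bform A (x + k *: z) (x + k *: z) =
    ((x^T + k *: z^T) *m A *m (x + k *: z)) 0 0.
  by rewrite /bform [(x + _)^T]linearD /= [(k *: z)^T]linearZ.
rewrite !mulmxDl !mulmxDr -!scalemxAl -!scalemxAr !(addE, scaleE) /bform.
ring.
Qed.

Lemma bform_delta A i j : bform A (delta_mx i 0) (delta_mx j 0) = A i j.
Proof. by rewrite /bform trmx_delta -rowE -colE !mxE. Qed.

Lemma bform_delta_l A i y : bform A (delta_mx i 0) y = (row i A *m y) 0 0.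
Proof. by rewrite /bform trmx_delta -rowE. Qed.

Lemma bform_sym A x y : A^T = A -> bform A x y = bform A y x.
Proof.
move=> As; rewrite /bform.
have -> : x^T *m A *m y = (y^T *m A *m x)^T.
  by rewrite !trmx_mul trmxK As mulmxA.
by rewrite mxE.
Qed.

(** Otherwise the form would take the value [-1] on a combination of the basis
    vectors [i] and [j]. *)
Lemma psd_diag0 A i j : A^T = A -> psd A -> A i i = 0 -> A i j = 0.
Proof.
move=> As Ap Aii; apply/eqP/negPn/negP => nz.
pose k := - (A j j + 1) / (2%:R * A i j).
have := Ap (delta_mx j 0 + k *: delta_mx i 0).
rewrite bform_line !bform_delta Aii mulr0 addr0.
have -> : A j i = A i j by rewrite -[in LHS]As mxE.
have -> : k * (A i j + A i j) = - (A j j + 1) by rewrite /k; field.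
by rewrite opprD addrA subrr sub0r ler0N1.
Qed.

(** Completing the square in the coordinate [i]: the new form at [y] is the old
    one at the point of the line [y + R e_i] where it is minimal. *)
Lemma psd_schur A i (r := row i A) : A^T = A -> psd A -> 0 < A i i ->
  psd (A - (A i i)^-1 *: (r^T *m r)).
Proof.
move=> As Ap Aii y; set a := A i i in Aii *.
pose be := (r *m y) 0 0.
have := Ap (y + (- (be / a)) *: delta_mx i 0).
rewrite bform_line bform_delta [bform A y (delta_mx i 0)]bform_sym //.
rewrite !bform_delta_l -/r -/be -/a.
have -> : bform (A - a^-1 *: (r^T *m r)) y y = bform A y y - a^-1 * be ^+ 2.
  rewrite /bform mulmxBr mulmxBl -scalemxAr -scalemxAl.
  rewrite [LHS]mxE [X in _ + X]mxE [X in - X]mxE; congr (_ - _ * _).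
  rewrite mulmxA -[y^T *m r^T *m r *m y]mulmxA -trmx_mul mxE big_ord1 mxE.
  by rewrite expr2.
suff -> : bform A y y + - (be / a) * (be + be) + (- (be / a)) ^+ 2 * a =
  bform A y y - a^-1 * be ^+ 2 by [].
by field; rewrite gt_eqF.
Qed.

(** Gaussian elimination; each step keeps the size of the matrix and clears one
    more row, so the induction is on the number of nonzero rows. *)
Lemma psd_gram A : A^T = A -> psd A ->
  exists s : seq 'rV[R]_t, A = \sum_(v <- s) v^T *m v.
Proof.
move: {2}#|_| (leqnn #|[set i | row i A != 0]|) => m.
elim: m A => [|m IHm] A.
  rewrite leqn0 cards_eq0 => /eqP A0 _ _; exists [::]; rewrite big_nil.
  apply/row_matrixP => i; rewrite row0; apply/eqP/negPn.
  by have := in_set0 i; rewrite -A0 inE => ->.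
move=> Am As Ap; case: (pickP (fun i => row i A != 0)) => [i Ai|A0]; last first.
  by apply: IHm => //; rewrite eq_card0 // => i; rewrite inE A0.
have Aii : 0 < A i i.
  rewrite lt_def -bform_delta Ap andbT bform_delta.
  apply: contraNneq Ai => Aii; apply/eqP/rowP => j.
  by rewrite !mxE; apply: psd_diag0.
pose r := row i A; pose B := A - (A i i)^-1 *: (r^T *m r).
have BE k : row k B = row k A - ((A i i)^-1 * A i k) *: r.
  by apply/rowP => j; rewrite !mxE big_ord1 !mxE mulrA.
have [|||s Bs] := IHm B.
- rewrite -ltnS; apply: leq_trans Am; apply: proper_card; apply/properP; split.
    apply/subsetP => k; rewrite !inE; apply: contraNneq => Ak.
    rewrite BE; have -> : A i k = 0.
      by rewrite -[in LHS]As mxE; move/rowP/(_ i): Ak; rewrite !mxE.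
    by rewrite Ak mulr0 scale0r subr0.
  exists i; rewrite !inE // BE mulVf ?gt_eqF // scale1r subrr eqxx.
  by [].
- by rewrite linearB linearZ /= trmx_mul trmxK As.
- exact: psd_schur.
exists (Num.sqrt (A i i)^-1 *: r :: s); rewrite big_cons -Bs.
rewrite [(_ *: r)^T]linearZ /= -scalemxAl -scalemxAr scalerA -expr2 sqr_sqrtr.
  by rewrite addrC subrK.
by rewrite invr_ge0 ltW.
Qed.
End Gram.

(** * Sums of squares of polynomial matrices *)

Section SosMatrix.
Variables (R : realType) (n t : nat).
Implicit Types (M N : 'M[{mpoly R[n]}]_t) (p : {mpoly R[n]}) (e c : R).

Lemma sum_delta (F : 'I_t -> {mpoly R[n]}) k :
  \sum_j F j * (k == j)%:R = F k.
Proof.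
rewrite (bigD1 k) //= eqxx mulr1 big1 ?addr0 // => j.
by rewrite eq_sym => /negPf ->; rewrite mulr0.
Qed.

Lemma sos_matrix_outer (v : 'rV[{mpoly R[n]}]_t) : sos_matrix (v^T *m v).
Proof. by exists 1%N, v. Qed.

Lemma sos_matrix0 : sos_matrix (0 : 'M[{mpoly R[n]}]_t).
Proof. by exists 0%N, 0; rewrite mulmx0. Qed.

Lemma sos_matrixD M N : sos_matrix M -> sos_matrix N -> sos_matrix (M + N).
Proof.
move=> [a [V ->]] [b [W ->]]; exists (a + b)%N, (col_mx V W).
by rewrite tr_col_mx mul_row_col.
Qed.

Lemma sos_matrix_sum (I : Type) (r : seq I) (P : pred I) F :
  (forall i, P i -> sos_matrix (F i : 'M[{mpoly R[n]}]_t)) ->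
  sos_matrix (\sum_(i <- r | P i) F i).
Proof.
by move=> h; apply: big_ind => //; [exact: sos_matrix0 | exact: sos_matrixD].
Qed.

Lemma sos_matrixZ p M : sos p -> sos_matrix M -> sos_matrix (p *: M).
Proof.
move=> [s ->] [a [V ->]]; rewrite scaler_suml; apply: sos_matrix_sum => q _.
exists a, (q *: V).
by rewrite [(q *: V)^T]linearZ /= -scalemxAl -scalemxAr scalerA expr2.
Qed.

Lemma sos_matrix_scalar p : sos p -> sos_matrix (p%:M : 'M[{mpoly R[n]}]_t).
Proof.
move=> sp; rewrite -scalemx1; apply: sos_matrixZ => //.
by exists t, 1%:M; rewrite trmx1 mul1mx.
Qed.

Definition approx_sos_matrix M := forall e, 0 < e ->
  exists D0, forall D, (D0 <= D)%N ->
  sos_matrix (M + (e%:MP * tail R n D)%:M).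

Lemma approx_sos_matrixD M N :
  approx_sos_matrix M -> approx_sos_matrix N -> approx_sos_matrix (M + N).
Proof.
move=> hM hN e e0; have e2 : 0 < e / 2%:R by rewrite divr_gt0.
have [[D0 sM] [D1 sN]] := (hM _ e2, hN _ e2).
exists (maxn D0 D1) => D; rewrite geq_max => /andP[/sM {}sM /sN {}sN].
have -> : e%:MP = (e / 2%:R)%:MP + (e / 2%:R)%:MP :> {mpoly R[n]}.
  by rewrite -mpolyCD -splitr.
by rewrite mulrDl raddfD /= addrACA; apply: sos_matrixD.
Qed.

Lemma approx_sos_matrix_sos M : sos_matrix M -> approx_sos_matrix M.
Proof.
move=> sM e e0; exists 0%N => D _; apply: sos_matrixD => //.
by apply/sos_matrix_scalar/sosM; [apply: sosC; exact: ltW | exact: sos_tail].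
Qed.

Lemma approx_sos_matrix_sum (I : Type) (r : seq I) (P : pred I) F :
  (forall i, P i -> approx_sos_matrix (F i)) ->
  approx_sos_matrix (\sum_(i <- r | P i) F i).
Proof.
move=> h; apply: big_ind => //; last exact: approx_sos_matrixD.
exact/approx_sos_matrix_sos/sos_matrix0.
Qed.

Lemma approx_sos_matrix_closed M :
  (forall e, 0 < e -> approx_sos_matrix (M + (e%:MP)%:M)) ->
  approx_sos_matrix M.
Proof.
move=> h e e0; have e2 : 0 < e / 2%:R by rewrite divr_gt0.
have [D0 sM] := h _ e2 _ e2; exists D0 => D /sM {}sM.
have -> : e%:MP = (e / 2%:R)%:MP + (e / 2%:R)%:MP :> {mpoly R[n]}.
  by rewrite -mpolyCD -splitr.
have -> : ((e / 2%:R)%:MP + (e / 2%:R)%:MP) * tail R n D =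
  (e / 2%:R)%:MP + (e / 2%:R)%:MP * tail R n D +
  (e / 2%:R)%:MP * \sum_(i < n) 'X_i ^+ (2 * D) by rewrite /tail; ring.
rewrite !raddfD /= !addrA; apply: sos_matrixD => //.
apply/sos_matrix_scalar/sosM; first by apply: sosC; exact: ltW.
by apply: sos_sum => i _; apply: sos_Xeven.
Qed.

(** Lagrange's identity:
    [|v|^2 |y|^2 - (v.y)^2 = sum_(i,j) (v_i y_j - v_j y_i)^2 / 2]. *)
Lemma outer_le_norm (v : 'rV[{mpoly R[n]}]_t) :
  sos_matrix ((\sum_i v 0 i ^+ 2)%:M - v^T *m v).
Proof.
pose u i j : 'rV[{mpoly R[n]}]_t := v 0 i *: delta_mx 0 j - v 0 j *: delta_mx 0 i.
suff -> : (\sum_i v 0 i ^+ 2)%:M - v^T *m v =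
    \sum_i \sum_j 2%:R^-1%:MP *: ((u i j)^T *m u i j).
  apply: sos_matrix_sum => i _; apply: sos_matrix_sum => j _.
  apply: sos_matrixZ; last exact: sos_matrix_outer.
  by apply: sosC; rewrite invr_ge0.
apply/matrixP => k l.
transitivity (2%:R^-1%:MP * \sum_i \sum_j
   (v 0 i ^+ 2 * (k == l)%:R * (k == j)%:R
     - v 0 i * v 0 j * (k == j)%:R * (l == i)%:R
     - v 0 i * v 0 j * (l == j)%:R * (k == i)%:R
     + v 0 j ^+ 2 * (k == l)%:R * (k == i)%:R)); last first.
  rewrite summxE mulr_sumr; apply: eq_bigr => i _.
  rewrite summxE mulr_sumr; apply: eq_bigr => j _.
  rewrite mxE outerE !mxE !eqxx /=.
  have d a : (k == a)%:R * (l == a)%:R = (k == l)%:R * (k == a)%:R :> {mpoly R[n]}.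
    by case: (eqVneq k a) => [->|]; rewrite ?mul1r ?mulr1 ?mul0r ?mulr0 // eq_sym.
  have -> : v 0 i ^+ 2 * (k == l)%:R * (k == j)%:R =
     v 0 i ^+ 2 * ((k == j)%:R * (l == j)%:R) by rewrite d; ring.
  have -> : v 0 j ^+ 2 * (k == l)%:R * (k == i)%:R =
     v 0 j ^+ 2 * ((k == i)%:R * (l == i)%:R) by rewrite d; ring.
  by ring.
have -> : \sum_i \sum_j
   (v 0 i ^+ 2 * (k == l)%:R * (k == j)%:R
     - v 0 i * v 0 j * (k == j)%:R * (l == i)%:R
     - v 0 i * v 0 j * (l == j)%:R * (k == i)%:R
     + v 0 j ^+ 2 * (k == l)%:R * (k == i)%:R) =
   2%:R * ((\sum_i v 0 i ^+ 2) * (k == l)%:R - v 0 k * v 0 l).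
  under eq_bigr => i _.
    have -> : \sum_j (v 0 i ^+ 2 * (k == l)%:R * (k == j)%:R
     - v 0 i * v 0 j * (k == j)%:R * (l == i)%:R
     - v 0 i * v 0 j * (l == j)%:R * (k == i)%:R
     + v 0 j ^+ 2 * (k == l)%:R * (k == i)%:R) =
     v 0 i ^+ 2 * (k == l)%:R - v 0 i * v 0 k * (l == i)%:R
     - v 0 i * v 0 l * (k == i)%:R + (\sum_j v 0 j ^+ 2) * (k == l)%:R * (k == i)%:R.
      rewrite big_split /= !sumrB sum_delta -!mulr_suml.
      by rewrite !(sum_delta (fun j => v 0 i * v 0 j)).
    over.
  rewrite big_split /= !sumrB (sum_delta (fun i => v 0 i * v 0 k)).
  rewrite (sum_delta (fun i => v 0 i * v 0 l)) (sum_delta (fun=> _)) -mulr_suml.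
  by ring.
rewrite mulrA mpoly_half mul1r [LHS]mxE [X in _ + X]mxE outerE mxE.
by rewrite mulr_natr.
Qed.

(** The perturbation [e * tail D] of [p] is spread by [v^T v] over all entries;
    [outer_le_norm] bounds it by a multiple of the identity. *)
Lemma approx_sos_outer p (v : 'rV[R]_t) : approx_sos p ->
  approx_sos_matrix (p *: map_mx (@mpolyC n R) (v^T *m v)).
Proof.
move=> hp e e0; pose w : 'rV[{mpoly R[n]}]_t := map_mx (@mpolyC n R) v.
have -> : map_mx (@mpolyC n R) (v^T *m v) = w^T *m w by rewrite map_mxM map_trmx.
pose c := \sum_i v 0 i ^+ 2.
have c0 : 0 <= c by apply: sumr_ge0 => i _; exact: sqr_ge0.
have cE : \sum_i w 0 i ^+ 2 = c%:MP.
  by rewrite rmorph_sum; apply: eq_bigr => i _; rewrite rmorphXn mxE.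
have c1 : 0 < c + 1 by rewrite ltr_wpDl.
have [D0 sp] := hp _ (divr_gt0 e0 c1); exists D0 => D /sp {}sp.
have := outer_le_norm w; rewrite cE => sw.
have -> : p *: (w^T *m w) + (e%:MP * tail R n D)%:M =
  (p + (e / (c + 1))%:MP * tail R n D) *: (w^T *m w) +
  ((e / (c + 1))%:MP * tail R n D) *: ((c%:MP)%:M - w^T *m w) +
  ((e / (c + 1))%:MP * tail R n D)%:M.
  have -> : e%:MP = (e / (c + 1))%:MP * (c%:MP + 1) :> {mpoly R[n]}.
    by rewrite -mpolyC1 -mpolyCD -mpolyCM divfK ?gt_eqF.
  set a := (e / _)%:MP; set T := tail _ _ _; set W := _ *m _.
  have -> : a * (c%:MP + 1) * T = a * T * c%:MP + a * T by ring.
  rewrite raddfD /= scalerDl scalerBr -[(a * T * _)%:M]scalemx1.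
  by rewrite -[(c%:MP)%:M]scalemx1 scalerA addrA addrACA subrr addr0.
have sT : sos ((e / (c + 1))%:MP * tail R n D).
  by apply: sosM; [apply: sosC; rewrite divr_ge0 // ltW | exact: sos_tail].
apply: sos_matrixD; last exact: sos_matrix_scalar.
by apply: sos_matrixD; apply: sos_matrixZ => //; exact: sos_matrix_outer.
Qed.

(** With [d_k] the unit row vectors, the matrix
    [(c - M_kl)/4 (d_k - d_l)^T (d_k - d_l) + (c + M_kl)/4 (d_k + d_l)^T (d_k + d_l)]
    has [M_kl / 2] in the places [(k, l)] and [(l, k)] and [c / 2] in the places
    [(k, k)] and [(l, l)]; summing over [k] and [l] gives the claim. *)
Lemma dominated_entries M c : M^T = M ->
  (forall k l, dominated c%:MP (M k l)) ->
  approx_sos_matrix (M + ((t%:R * c)%:MP)%:M).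
Proof.
move=> Ms hM.
pose d k : 'rV[R]_t := delta_mx 0 k.
pose sq (v : 'rV[R]_t) : 'M[{mpoly R[n]}]_t := map_mx (@mpolyC n R) (v^T *m v).
pose h : {mpoly R[n]} := 2%:R^-1%:MP.
suff -> : M + ((t%:R * c)%:MP)%:M = \sum_k \sum_l
   ((h * h * (c%:MP - M k l)) *: sq (d k - d l) +
    (h * h * (c%:MP + M k l)) *: sq (d k + d l)).
  have ah : approx_sos h by apply: approx_sosC; rewrite invr_ge0.
  apply: approx_sos_matrix_sum => k _; apply: approx_sos_matrix_sum => l _.
  have [hm hp] := hM k l.
  by apply: approx_sos_matrixD; apply: approx_sos_outer;
    apply: approx_sosM => //; apply: approx_sosM.
apply/matrixP => i j.
have Mji : M j i = M i j by rewrite -[in LHS]Ms mxE.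
transitivity (h * \sum_k \sum_l
   (c%:MP * (i == j)%:R * (i == k)%:R + c%:MP * (i == j)%:R * (i == l)%:R
    + M k l * (i == k)%:R * (j == l)%:R + M k l * (j == k)%:R * (i == l)%:R)).
  under eq_bigr => k _.
    rewrite !big_split /= sum_delta sumr_const card_ord.
    rewrite (sum_delta (fun l => M k l * (i == k)%:R)).
    rewrite (sum_delta (fun l => M k l * (j == k)%:R)).
    over.
  rewrite !big_split /= (sum_delta (fun k => M k j)) (sum_delta (fun k => M k i)).
  rewrite sumr_const card_ord Mji -addrA -mulr2n.
  rewrite sumrMnl (sum_delta (fun=> c%:MP * (i == j)%:R)) -mulr2n -mulrnA.
  rewrite [LHS]mxE [X in _ + X]mxE mpolyCM mpolyC_nat -mulr_natr.
  by rewrite -[LHS]mul1r -[X in X * _ = _]mpoly_half -/h; ring.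
rewrite summxE mulr_sumr; apply: eq_bigr => k _.
rewrite summxE mulr_sumr; apply: eq_bigr => l _.
have sqE v : sq v i j = (v 0 i)%:MP * (v 0 j)%:MP.
  by rewrite mxE outerE mpolyCM.
rewrite [RHS]mxE [X in _ = X + _]mxE [X in _ = _ + X]mxE !sqE !mxE !eqxx /=.
rewrite !mpolyCB !mpolyCD !mpolyC_nat.
have ij a : (i == a)%:R * (j == a)%:R = (i == j)%:R * (i == a)%:R :> {mpoly R[n]}.
  by case: (eqVneq i a) => [->|]; rewrite ?mul1r ?mulr1 ?mul0r ?mulr0 // eq_sym.
rewrite -![_ * (i == j)%:R * _]mulrA -!ij.
rewrite -[h in LHS]mul1r -[X in X * _ * _ = _]mpoly_half -/h.
ring.
Qed.

(** A quadrature with nodes [z_k] replaces [H] by [sum_k b_k * H(z_k)], to which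
    [psd_gram] and [approx_sos_outer] apply; the error is entrywise small and
    [dominated_entries] absorbs it in a small multiple of the identity. *)
Lemma approx_sos_matrix_psd (H : 'M[{mpoly R[n]}]_t) : H^T = H ->
  (forall z, in_box z -> psd (map_mx (meval z) H)) -> approx_sos_matrix H.
Proof.
move=> Hs Hp; apply: approx_sos_matrix_closed => e e0.
have e1 : 0 < e / t.+1%:R by rewrite divr_gt0 // ltr0n.
have [K [b [z [d [[bpos zbox _ _ _] happ]]]]] :=
  quadrature_approx (fun ij : 'I_t * 'I_t => H ij.1 ij.2) e1.
pose G k := map_mx (@mpolyC n R) (map_mx (meval (z k)) H).
pose E := H - \sum_k b k *: G k.
have Gs k : (G k)^T = G k by rewrite /G !map_trmx Hs.
have Es : E^T = E.
  rewrite /E linearB linear_sum /= Hs; congr (_ - _).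
  by apply: eq_bigr => k _; rewrite linearZ /= Gs.
have hE : forall k l, dominated (e / t.+1%:R)%:MP (E k l).
  move=> k l; rewrite mxE [X in _ + X]mxE summxE.
  have := happ (k, l); congr (dominated _ (_ - _)).
  by apply: eq_bigr => m _; rewrite !mxE.
have := dominated_entries Es hE; rewrite /E => aE.
have -> : H + (e%:MP)%:M = H - \sum_k b k *: G k +
    ((t%:R * (e / t.+1%:R))%:MP)%:M + \sum_k b k *: G k +
    ((e / t.+1%:R)%:MP)%:M.
  have -> : e%:MP = (t%:R * (e / t.+1%:R))%:MP + (e / t.+1%:R)%:MP :> {mpoly R[n]}.
    rewrite -mpolyCD; congr (_%:MP).
    by rewrite -natr1; field; rewrite natr1 pnatr_eq0.
  by rewrite raddfD /= addrA; congr (_ + _); rewrite addrAC subrK.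
apply: approx_sos_matrixD; last first.
  by apply/approx_sos_matrix_sos/sos_matrix_scalar/sosC/ltW.
apply: approx_sos_matrixD => //; apply: approx_sos_matrix_sum => k _.
have [|s Gk] := psd_gram _ (Hp _ (zbox k)); first by rewrite map_trmx Hs.
rewrite /G Gk.
rewrite raddf_sum /= scaler_sumr; apply: approx_sos_matrix_sum => v _.
exact: approx_sos_outer.
Qed.
End SosMatrix.

(** * The Hessian of a function convex on the box *)

Section Convex.
Variables (R : realType) (n : nat).
Implicit Types (g p : {mpoly R[n]}) (q : {poly R}) (x y z : 'I_n -> R).

(** One-sided continuity at [0]. *)
Lemma poly_ge0_right q (d : R) : 0 < d ->
  (forall s, 0 < s < d -> 0 <= q.[s]) -> 0 <= q.[0].
Proof.
move=> d0; elim/poly_ind: q => [|q c _] hq; first by rewrite horner0.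
rewrite !hornerE in hq *.
have hqs s : 0 < s < d -> 0 <= q.[s] * s + c by move/hq; rewrite !hornerE.
pose B := \sum_(i < size q) `|q`_i| + 1.
have B0 : 0 < B by rewrite ltr_wpDl // sumr_ge0.
have qB s : 0 < s < 1 -> q.[s] <= B.
  move=> /andP[s0 s1]; rewrite horner_coef; apply: ler_wpDr => //.
  apply: ler_sum => i _; apply: le_trans (ler_norm _) _; rewrite normrM.
  rewrite ler_piMr // normrX (gtr0_norm s0) exprn_ile1 //; exact: ltW.
rewrite leNgt; apply/negP => c0.
pose s := Num.min (d / 2%:R) (Num.min (2%:R^-1) (- c / (2%:R * B))).
have s0 : 0 < s.
  rewrite !lt_min divr_gt0 // invr_gt0 ltr0n /=.
  by rewrite divr_gt0 ?oppr_gt0 // mulr_gt0.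
have sd : s < d.
  by rewrite gt_min ltr_pdivrMr // ltr_pMr // ltr1n.
have s1 : s < 1 by rewrite !gt_min invf_lt1 ?ltr1n ?orbT.
have sB : s * B <= - c / 2%:R.
  rewrite -ler_pdivlMr // !ge_min; apply/orP; right; apply/orP; right.
  by rewrite invfM mulrA.
have qs : q.[s] * s <= s * B by rewrite mulrC ler_pM2l // qB // s0.
have := hqs s; rewrite s0 sd => /(_ isT); apply/negP; rewrite -ltNge.
lra.
Qed.

Lemma poly_deriv2_ge0 q (d : R) : 0 < d ->
  (forall s, 0 < s < d -> 0 <= q.[s] + q.[- s] - 2%:R * q.[0]) ->
  0 <= q^`()^`().[0].
Proof.
move=> d0; elim/poly_ind: q => [|q a _]; first by rewrite !derivE horner0.
elim/poly_ind: q => [|q b _].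
  by rewrite !derivE !hornerE.
move=> h.
have -> : (((q * 'X + b%:P) * 'X + a%:P)^`()^`()).[0] = (q + (q \Po (- 'X))).[0].
  rewrite !derivE !hornerE horner_comp !hornerE oppr0.
  by rewrite /= addr0.
apply: (poly_ge0_right d0) => s sd; have /andP[s0 _] := sd.
rewrite !hornerE horner_comp !hornerE.
have E v : ((q * 'X + b%:P) * 'X + a%:P).[v] = (q.[v] * v + b) * v + a.
  by rewrite !hornerE.
have := h s sd; rewrite !E.
have -> : (q.[s] * s + b) * s + a + ((q.[- s] * - s + b) * - s + a) -
    2%:R * ((q.[0] * 0 + b) * 0 + a) = s ^+ 2 * (q.[s] + q.[- s]) by ring.
by rewrite pmulr_rge0 // exprn_gt0.
Qed.

(** The restriction of [p] to the line [s |-> x + s * y], as a polynomial in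
    [s]. *)
Definition on_line x y p : {poly R} :=
  mmap (@polyC R) (fun i => (x i)%:P + (y i)%:P * 'X) p.

Lemma horner_on_line x y p s :
  (on_line x y p).[s] = p.@[fun i => x i + y i * s].
Proof.
elim/mpoly_ring_ind: p => [c|i|p q hp hq|p q hp hq].
- by rewrite /on_line mmapC mevalC hornerC.
- by rewrite /on_line mmapX mmap1U mevalXU !hornerE.
- by rewrite /on_line rmorphD /= hornerD hp hq mevalD.
- by rewrite /on_line rmorphM /= hornerM hp hq mevalM.
Qed.

Lemma mderivXU (i j : 'I_n) : ('X_i)^`M(j) = (i == j)%:R :> {mpoly R[n]}.
Proof.
rewrite mderivX mnm1E; case: eqVneq => [->|_]; last by rewrite scale0r.
rewrite scale1r -[RHS]mpolyX0; congr 'X_[_].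
by apply/mnmP => k; rewrite mnmBE subnn mnmE.
Qed.

Lemma deriv_on_line x y p :
  (on_line x y p)^`() = \sum_i (y i)%:P * on_line x y p^`M(i).
Proof.
elim/mpoly_ring_ind: p => [c|i|p q hp hq|p q hp hq].
- rewrite /on_line mmapC derivC big1 // => i _.
  by rewrite mderivC mmap0 mulr0.
- rewrite (bigD1 i) //= big1 => [|j]; rewrite /on_line mderivXU.
    rewrite eqxx rmorph_nat mulr1 addr0 mmapX mmap1U !derivE.
    by rewrite add0r mulr1.
  by move=> ji; rewrite eq_sym (negPf ji) rmorph_nat mulr0.
- rewrite /on_line rmorphD /= derivD hp hq -big_split; apply: eq_bigr => i _.
  by rewrite mderivD rmorphD mulrDr.
- rewrite /on_line rmorphM /= derivM hp hq mulr_suml mulr_sumr -big_split.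
  apply: eq_bigr => i _ /=.
  by rewrite mderivM rmorphD !rmorphM /=; ring.
Qed.

(** At an interior point [r * z] both directions of the line stay in the box for
    a short while, so midpoint convexity bounds the second difference below. *)
Lemma hessian_psd_interior g z (r : R) : convex_on_box (fun x => g.@[x]) ->
  in_box z -> 0 <= r < 1 -> psd (map_mx (meval (fun i => z i * r)) (hessian g)).
Proof.
move=> hg hz /andP[r0 r1] y.
pose w i := y i 0; pose x i := z i * r.
pose q := on_line x w g.
have -> : bform (map_mx (meval x) (hessian g)) y y = q^`()^`().[0].
  rewrite deriv_on_line raddf_sum /= horner_sum bformE; apply: eq_bigr => i _.
  rewrite derivM derivC mul0r add0r deriv_on_line hornerM hornerC horner_sum.
  rewrite mulr_sumr; apply: eq_bigr => j _.
  rewrite hornerM hornerC horner_on_line !mxE -mulrA; congr (_ * _).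
  rewrite mulrC; congr (_ * _); apply: meval_eq => k.
  by rewrite mulr0 addr0.
pose Y := \sum_i `|w i| + 1.
have Y0 : 0 < Y by rewrite ltr_wpDl // sumr_ge0.
have d0 : 0 < (1 - r) / Y by rewrite divr_gt0 // subr_gt0.
apply: (poly_deriv2_ge0 d0) => s /andP[s0 sd].
rewrite !horner_on_line.
have box (u : R) : `|u| <= s -> in_box (fun i => x i + w i * u).
  move=> us i; rewrite -ler_norml.
  have zi : `|z i| <= 1 by rewrite ler_norml; exact: hz.
  have wi : `|w i| <= Y.
    rewrite /Y (bigD1 i) //= -addrA lerDl addr_ge0 // sumr_ge0 //.
  have xi : `|x i| <= r by rewrite /x normrM (ger0_norm r0) ler_piMl.
  have wu : `|w i * u| <= Y * ((1 - r) / Y).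
    rewrite normrM; apply: ler_pM => //; apply: le_trans us _; exact: ltW.
  rewrite [Y * _]mulrC divfK ?gt_eqF // in wu.
  apply: le_trans (ler_normD _ _) _; lra.
have sbox : in_box (fun i => x i + w i * s) by apply: box; rewrite gtr0_norm.
have nbox : in_box (fun i => x i + w i * - s).
  by apply: box; rewrite normrN gtr0_norm.
have l01 : 0 <= (2%:R^-1 : R) <= 1.
  by rewrite invr_ge0 ler0n invf_le1 // ler1n.
have := hg _ _ sbox nbox _ l01.
have -> : (g.@[fun i => 2%:R^-1 * (x i + w i * s) +
                      (1 - 2%:R^-1) * (x i + w i * - s)]) =
          g.@[fun i => x i + w i * 0].
  by apply: meval_eq => i; field.
lra.
Qed.

(** Boundary points are reached along the segment from the centre. *)
Lemma hessian_psd g z : convex_on_box (fun x => g.@[x]) ->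
  in_box z -> psd (map_mx (meval z) (hessian g)).
Proof.
move=> hg hz y.
pose q := \sum_i \sum_j (y i 0 * y j 0)%:P *
  on_line z (fun i => - z i) (hessian g i j).
have qE s : q.[s] = bform (map_mx (meval (fun i => z i * (1 - s))) (hessian g)) y y.
  rewrite bformE horner_sum; apply: eq_bigr => i _.
  rewrite horner_sum; apply: eq_bigr => j _.
  rewrite hornerM hornerC horner_on_line !mxE mulrAC; congr (_ * _ * _).
  by apply: meval_eq => k; ring.
have : 0 <= q.[0].
  apply: (@poly_ge0_right _ 1) => // s /andP[s0 s1]; rewrite qE.
  apply: hessian_psd_interior => //.
  by rewrite subr_ge0 ltW //= ltrBlDr ltrDl.
rewrite qE; congr (0 <= bform _ _ _); apply/matrixP => i j; rewrite !mxE.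
by apply: meval_eq => k; rewrite subr0 mulr1.
Qed.
End Convex.

(** * The Hessian of Theta *)

Section Theta.
Variables (R : realType) (n : nat).
Implicit Types (p q : {mpoly R[n]}) (i j k l : 'I_n).

Lemma hessianD p q : hessian (p + q) = hessian p + hessian q.
Proof. by apply/matrixP => i j; rewrite !mxE !mderivD. Qed.

Lemma hessianZ c p : hessian (c *: p) = c%:MP *: hessian p.
Proof. by apply/matrixP => i j; rewrite !mxE !mderivZ mul_mpolyC. Qed.

Lemma hessian_sum (I : Type) (r : seq I) (P : pred I) (F : I -> {mpoly R[n]}) :
  hessian (\sum_(i <- r | P i) F i) = \sum_(i <- r | P i) hessian (F i).
Proof.
apply: (big_morph _ hessianD); apply/matrixP => i j.
by rewrite !mxE !mderiv0.
Qed.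

Lemma mderiv_nat k m : (m%:R : {mpoly R[n]})^`M(k) = 0.
Proof. by rewrite -mpolyC_nat mderivC. Qed.

Lemma mderivXn i k m : ('X_i ^+ m.+1)^`M(k) =
  (i == k)%:R * m.+1%:R * 'X_i ^+ m :> {mpoly R[n]}.
Proof.
elim: m => [|m IHm]; first by rewrite expr1 mderivXU expr0 !mulr1.
rewrite exprS mderivM IHm mderivXU -[m.+2%:R]natr1 exprS; ring.
Qed.

Lemma mderiv2_pow i k l m : ('X_i ^+ m.+2)^`M(k)^`M(l) =
  m.+2%:R * m.+1%:R * 'X_i ^+ m * ((i == k)%:R * (i == l)%:R) :> {mpoly R[n]}.
Proof.
rewrite mderivXn mderivM mderivXn -natrM mderiv_nat natrM; ring.
Qed.

(** The shape of a summand of [Theta]; the second derivatives are hypotheses so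
    that each monomial can bring its own formula. *)
Lemma mderiv2_sum p1 p2 p3 p4 q1 q2 q3 q4 m k l :
  p1^`M(k)^`M(l) = q1 -> p2^`M(k)^`M(l) = q2 ->
  p3^`M(k)^`M(l) = q3 -> p4^`M(k)^`M(l) = q4 ->
  (p1 *+ m + p2 + p3 + p4 *+ m)^`M(k)^`M(l) = q1 *+ m + q2 + q3 + q4 *+ m.
Proof. by move=> <- <- <- <-; rewrite !mderivD !mderivMn. Qed.

Lemma mderiv2M p q k l : (p * q)^`M(k)^`M(l) =
  p^`M(k)^`M(l) * q + p^`M(k) * q^`M(l) + p^`M(l) * q^`M(k)
    + p * q^`M(k)^`M(l).
Proof. by rewrite mderivM mderivD !mderivM; ring. Qed.

Lemma mderiv2_pow_sqr i j k l m : ('X_i ^+ m.+2 * 'X_j ^+ 2)^`M(k)^`M(l) =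
  m.+2%:R * m.+1%:R * 'X_i ^+ m * 'X_j ^+ 2 * ((i == k)%:R * (i == l)%:R) +
  2%:R * m.+2%:R * 'X_i ^+ m.+1 * 'X_j *
    ((i == k)%:R * (j == l)%:R + (j == k)%:R * (i == l)%:R) +
  2%:R * 'X_i ^+ m.+2 * ((j == k)%:R * (j == l)%:R) :> {mpoly R[n]}.
Proof.
rewrite mderiv2M !mderiv2_pow !mderivXn !expr1 expr0; ring.
Qed.

Lemma sos_diag_mx k : sos_matrix (delta_mx k k : 'M[{mpoly R[n]}]_n).
Proof.
exists 1%N, (delta_mx 0 k).
by rewrite trmx_delta mul_delta_mx.
Qed.

Definition Theta_pair d i j : {mpoly R[n]} :=
  8%:R * 'X_i ^+ (2 * d + 2) + 'X_i ^+ (2 * d) * 'X_j ^+ 2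
  + 'X_i ^+ 2 * 'X_j ^+ (2 * d) + 8%:R * 'X_j ^+ (2 * d + 2).

(** [p^(m+1) + q^(m+1) - p q^m - p^m q = (p - q) (p^m - q^m)] has the factor
    [(p - q)^2]. *)
Lemma sos_pow_rearrange p q m : sos p -> sos q ->
  sos (p ^+ m.+1 + q ^+ m.+1 - p * q ^+ m).
Proof.
move=> sp sq.
have -> : p ^+ m.+1 + q ^+ m.+1 - p * q ^+ m =
  (p - q) * (p ^+ m - q ^+ m) + p ^+ m * q by rewrite !exprS; ring.
apply: sosD; last by apply: sosM => //; apply: sosX.
rewrite subrXX mulrA -expr2; apply: sosM; first exact: sos_sqr.
by apply: sos_sum => i _; apply: sosM; apply: sosX.
Qed.

(** A matrix supported on the rows and columns [i], [j] from which two squares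
    are split off; the squares are meant to take up the off-diagonal entry. *)
Lemma pair_decomposition (S : comNzRingType) (t : nat) (i j : 'I_t)
    (M : 'M[S]_t) (f1 f2 g1 g2 r1 r2 w : S) :
  (forall k l : 'I_t, M k l =
     (f1 ^+ 2 + g1 ^+ 2 + r1 + w) * ((i == k)%:R * (i == l)%:R) +
     (f1 * f2 + g1 * g2) *
       ((i == k)%:R * (j == l)%:R + (j == k)%:R * (i == l)%:R) +
     (f2 ^+ 2 + g2 ^+ 2 + r2 + w) * ((j == k)%:R * (j == l)%:R)) ->
  let vec a b : 'rV[S]_t := a *: delta_mx 0 i + b *: delta_mx 0 j in
  M - w *: (delta_mx i i + delta_mx j j) =
  (vec f1 f2)^T *m vec f1 f2 + (vec g1 g2)^T *m vec g1 g2 +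
  r1 *: delta_mx i i + r2 *: delta_mx j j.
Proof.
move=> hM vec; apply/matrixP => k l.
have addE (A B : 'M[S]_t) : (A + B) k l = A k l + B k l by rewrite mxE.
have oppE (A : 'M[S]_t) : (- A) k l = - A k l by rewrite mxE.
have scaleE c (A : 'M[S]_t) : (c *: A) k l = c * A k l by rewrite mxE.
have dE a : (delta_mx a a : 'M[S]_t) k l = (a == k)%:R * (a == l)%:R.
  by rewrite mxE ![_ == a]eq_sym -natrM mulnb.
have vE a b c : vec a b 0 c = a * (i == c)%:R + b * (j == c)%:R.
  by rewrite !mxE !eqxx /= ![c == _]eq_sym.
rewrite !addE oppE !scaleE addE !outerE !dE !vE hM; ring.
Qed.

(** With [u = x_i] and [v = x_j], the off-diagonal entry
    [4d u^(2d-1) v + 4d u v^(2d-1)] is taken up by the squares of the vectors with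
    entries [(4d u^d, u^(d-1) v)] and [(v^(d-1) u, 4d v^d)].  They use
    [16 d^2 u^(2d)] of the available [8 (2d+2) (2d+1) u^(2d)] on the diagonal,
    and a term [u^2 v^(2d-2)] that [sos_pow_rearrange] bounds by
    [u^(2d) + v^(2d)]. *)
Lemma hessian_pair d i j : (0 < d)%N ->
  sos_matrix (hessian (Theta_pair d i j) -
    ('X_i ^+ (2 * d) + 'X_j ^+ (2 * d)) *: (delta_mx i i + delta_mx j j)).
Proof.
(* From here on d = m + 1; D stands for 4 * d and res for the unused diagonal. *)
case: d => // m _; set u : {mpoly R[n]} := 'X_i; set v : {mpoly R[n]} := 'X_j.
pose D : {mpoly R[n]} := 4%:R * (1 + m%:R).
pose c1 := (16 * (m * m) + 80 * m + 78)%N; pose c2 := ((2 * m + 2) * (2 * m + 1))%N.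
pose res (x y : {mpoly R[n]}) : {mpoly R[n]} :=
  c1%:R * (x ^+ 2) ^+ m.+1 + c2%:R * ((x ^+ 2) ^+ m * y ^+ 2) +
  ((x ^+ 2) ^+ m.+1 + (y ^+ 2) ^+ m.+1 - x ^+ 2 * (y ^+ 2) ^+ m).
have sres x y : sos (res x y).
  have s2 : forall z : {mpoly R[n]}, sos (z ^+ 2) by move=> z; apply: sos_sqr.
  apply: sosD; last exact: sos_pow_rearrange.
  by apply: sosD; apply: sosM; try exact: sosn; [exact: sosX | apply: sosM => //; exact: sosX].
rewrite (@pair_decomposition _ _ i j _ (D * u ^+ m.+1) (u ^+ m * v)
  (v ^+ m * u) (D * v ^+ m.+1) (res u v) (res v u)).
  apply: sos_matrixD; last by apply: sos_matrixZ => //; exact: sos_diag_mx.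
  apply: sos_matrixD; last by apply: sos_matrixZ => //; exact: sos_diag_mx.
  by apply: sos_matrixD; exact: sos_matrix_outer.
move=> k l; rewrite mxE.
have -> : Theta_pair m.+1 i j = 'X_i ^+ (2 * m).+4 *+ 8 +
    'X_i ^+ (2 * m).+2 * 'X_j ^+ 2 + 'X_j ^+ (2 * m).+2 * 'X_i ^+ 2 +
    'X_j ^+ (2 * m).+4 *+ 8.
  rewrite /Theta_pair ['X_i ^+ 2 * _]mulrC ![8%:R * _]mulr_natl.
  by rewrite mulnS [(2 + 2 * m + 2)%N]addnC.
rewrite (mderiv2_sum _ (mderiv2_pow i k l _) (mderiv2_pow_sqr i j k l _)
                       (mderiv2_pow_sqr j i k l _) (mderiv2_pow j k l _)).
rewrite -/u -/v.
have [k1 k2 k3] : [/\ (2 * m).+4%:R = 2%:R * m%:R + 4%:R :> {mpoly R[n]},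
    (2 * m).+3%:R = 2%:R * m%:R + 3%:R :> {mpoly R[n]} &
    (2 * m).+2%:R = 2%:R * m%:R + 2%:R :> {mpoly R[n]}].
  by rewrite -natrM -!natrD !addnS addn0.
have k4 : (2 * m).+1%:R = 2%:R * m%:R + 1 :> {mpoly R[n]} by rewrite -natr1 natrM.
rewrite k1 k2 k3 k4 /res.
have [-> ->] : c1%:R = 16%:R * (m%:R * m%:R) + 80%:R * m%:R + 78%:R :> {mpoly R[n]} /\
    c2%:R = (2%:R * m%:R + 2%:R) * (2%:R * m%:R + 1) :> {mpoly R[n]}.
  by rewrite /c1 /c2 !(natrD, natrM); split.
have pE (x : {mpoly R[n]}) : x ^+ (2 * m.+1) = (x ^+ m) ^+ 2 * x ^+ 2.
  by rewrite mulnC exprM [x ^+ m.+1]exprS exprMn mulrC.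
have qE (x : {mpoly R[n]}) : x ^+ (2 * m) = (x ^+ m) ^+ 2 by rewrite mulnC exprM.
rewrite (pE u) (pE v) !exprS !expr0 !mulr1 (qE u) (qE v) !exprMn /D.
move: (u ^+ m) (v ^+ m) => U V.
ring.
Qed.

Lemma hessian_sqr i : hessian ('X_i ^+ 2 : {mpoly R[n]}) = 2%:R *: delta_mx i i.
Proof.
apply/matrixP => k l; rewrite !mxE (mderiv2_pow i k l 0) expr0 !mulr1.
by rewrite -natrM mulnb ![i == _]eq_sym.
Qed.

(** Every unordered pair containing [k] contributes to the [k]th diagonal
    entry. *)
Lemma sum_pairs_diag (w : 'I_n -> 'I_n -> {mpoly R[n]}) :
  (forall i j, w i j = w j i) ->
  \sum_(i < n) \sum_(j < n | (i < j)%N) w i j *: (delta_mx i i + delta_mx j j) =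
  \sum_k (\sum_(j | j != k) w k j) *: (delta_mx k k : 'M[{mpoly R[n]}]_n).
Proof.
move=> ws.
under eq_bigr => i _ do (under eq_bigr do rewrite scalerDr; rewrite big_split /=).
rewrite big_split /= [X in _ + X](exchange_big_dep xpredT) //= -big_split /=.
apply: eq_bigr => k _; rewrite -!scaler_suml -scalerDl; congr (_ *: _).
rewrite [RHS](bigID (fun j : 'I_n => (k < j)%N)) /=; congr (_ + _).
  by apply: eq_bigl => j; rewrite -val_eqE /=; case: ltngtP.
rewrite (eq_bigr (fun j => w k j)) => [|j _]; last exact: ws.
by apply: eq_bigl => j; rewrite -val_eqE /=; case: ltngtP.
Qed.

(** The squares [x_i^2] of [Theta] give twice the identity, and the pairs give
    [sum_(j != k) (x_k^(2d) + x_j^(2d))] in the [k]th diagonal entry.  This is at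
    least [sum_j x_j^(2d)] as soon as [k] has at least one partner. *)
Lemma sos_matrix_hessian_Theta d : n != 1%N -> (0 < d)%N ->
  sos_matrix (hessian (Theta R n d) - (tail R n d)%:M).
Proof.
move=> n1 d0; pose a i : {mpoly R[n]} := 'X_i ^+ (2 * d).
rewrite /Theta hessianD !hessian_sum.
under eq_bigr do rewrite hessian_sqr.
under [X in _ + X - _]eq_bigr do rewrite hessian_sum.
rewrite -scaler_sumr -mx1_sum_delta.
pose S i j := hessian (Theta_pair d i j) - (a i + a j) *: (delta_mx i i + delta_mx j j).
have -> : \sum_(i < n) \sum_(j < n | (i < j)%N) hessian (Theta_pair d i j) =
  \sum_(i < n) \sum_(j < n | (i < j)%N) S i j +
  \sum_(i < n) \sum_(j < n | (i < j)%N) (a i + a j) *: (delta_mx i i + delta_mx j j).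
  rewrite -big_split; apply: eq_bigr => i _ /=.
  by rewrite -big_split; apply: eq_bigr => j _; rewrite /= subrK.
rewrite (@sum_pairs_diag (fun i j => a i + a j)); last by move=> *; exact: addrC.
have -> : \sum_k (\sum_(j | j != k) (a k + a j)) *: (delta_mx k k : 'M[{mpoly R[n]}]_n) =
   (\sum_k a k)%:M + \sum_k (n.-2%:R * a k) *: delta_mx k k.
  rewrite -scalemx1 mx1_sum_delta scaler_sumr -big_split; apply: eq_bigr => k _ /=.
  have nE : n.-1 = n.-2.+1.
    by move: n1 (leq_ltn_trans (leq0n k) (ltn_ord k)); case: (n) => [|[]].
  rewrite -scalerDl; congr (_ *: _).
  rewrite big_split /= sumr_const cardC1 card_ord nE [in RHS](bigD1 k) //=.
  by rewrite -[_ *+ _.+1]mulr_natl -natr1; ring.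
have double_cancel (V : zmodType) (o s b r : V) :
    o *+ 2 + (s + (b + r)) - (o + b) = o + (s + r).
  apply/eqP; rewrite subr_eq; apply/eqP.
  by rewrite mulr2n [RHS]addrACA; congr (_ + _); rewrite addrA addrAC.
rewrite -[tail R n d]/(1 + \sum_k a k) raddfD /= scaler_nat double_cancel.
apply: sos_matrixD; first exact/sos_matrix_scalar/(sosn _ _ 1).
apply: sos_matrixD.
  apply: sos_matrix_sum => i _; apply: sos_matrix_sum => j _.
  exact: hessian_pair.
apply: sos_matrix_sum => k _; apply: sos_matrixZ; last exact: sos_diag_mx.
by apply: sosM; [exact: sosn | exact: sos_Xeven].
Qed.
End Theta.

(* The case n = 1 is excluded because the claim is false there: the sum over
   pairs in Theta is empty, and 6x^2 - x^4 (convex on [-1,1]) plus x^2 has a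
   negative second derivative at x = 2. *)
Theorem theorem3p1 (R : realType) (n : nat) (hn : n != 1%N)
    (g : {mpoly R[n]}) (hg : convex_on_box (fun x : 'I_n -> R => g.@[x])) :
  forall eps : R, 0 < eps ->
  exists d0 : nat, forall d : nat, (d0 <= d)%N ->
    sos_convex (g + eps *: Theta R n d).
Proof.
move=> eps eps0.
have Hs : (hessian g)^T = hessian g.
  by apply/matrixP => i j; rewrite !mxE mderiv_comm.
have [d0 hd0] := approx_sos_matrix_psd Hs (fun z => @hessian_psd R n g z hg) eps0.
exists d0.+1 => d d0d; rewrite /sos_convex hessianD hessianZ.
have -> : hessian g + eps%:MP *: hessian (Theta R n d) =
  hessian g + (eps%:MP * tail R n d)%:M +
  eps%:MP *: (hessian (Theta R n d) - (tail R n d)%:M).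
  by rewrite scalerBr -scale_scalar_mx addrA addrAC addrK.
apply: sos_matrixD; first by apply: hd0; exact: ltnW.
apply: sos_matrixZ; first by apply: sosC; exact: ltW.
by apply: sos_matrix_hessian_Theta => //; apply: leq_ltn_trans d0d.
Qed.
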